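(* Let $(\mathcal{G},\|\cdot\|)$ be an arithmetical semigroup satisfying Axiom $A$ with constant $c_{\mathcal{G}}$, and let $S\subseteq\mathcal{P}$ have natural density $\delta(S)$. Let $f\colon[1,\infty)\to\mathbb{C}$ be bounded with $f(1)=0$, and let $a\colon\mathcal{G}\to\mathbb{C}$ be supported on $\mathfrak{D}(\mathcal{G},S)$ with $a(e_{\mathcal{G}})=1$ and $\lim_{x\to\infty}\sum_{2\le\|g\|\le x,\ g\in\mathfrak{D}(\mathcal{G},S)}\frac{|a(g)|}{\|g\|}\log\log\|g\|<\infty$. Then the following are equivalent: (i) $\sum_{\|g\|\le x}Q_S(g)f(\mathrm{N}^+(g))=c_{\mathcal{G}}\delta(S)x+o(x)$ as $x\to\infty$; (ii) $-\lim_{x\to\infty}\sum_{\|g\|\le x,\ g\in\mathfrak{D}(\mathcal{G},S),\ g\ne e_{\mathcal{G}}}\frac{\mu(g)f(\mathrm{N}_-(g))}{\|g\|}=\delta(S)$; (iii) $-\lim_{x\to\infty}\sum_{\|g\|\le x,\ g\in\mathfrak{D}(\mathcal{G},S),\ g\ne e_{\mathcal{G}}}\frac{(\mu*a)(g)f(\mathrm{N}_-(g))}{\|g\|}=\delta(S)$.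
   Context: An arithmetical semigroup is a commutative monoid $\mathcal{G}$ with identity $e_{\mathcal{G}}$ freely generated by a finite or countable set $\mathcal{P}$ of primes, with a multiplicative norm $\|\cdot\|$, $\|e_{\mathcal{G}}\|=1$, $\|P\|>1$ for primes, $\mathcal{N}(x)=\#\{g:\|g\|\le x\}<\infty$. Axiom $A$: $\mathcal{N}(x)=c_{\mathcal{G}}x+O(x^{\eta})$ with $c_{\mathcal{G}}>0$, $0<\eta<1$. Natural density: $\delta(S)=\lim_{x\to\infty}\#\{P\in S:\|P\|\le x\}/\#\{P\in\mathcal{P}:\|P\|\le x\}$. $h\mid g$ means $g=hr$. For $g\ne e_{\mathcal{G}}$, $\mathrm{N}_-(g)$ and $\mathrm{N}^+(g)$ are the minimal and maximal norms of primes dividing $g$; $\mathrm{N}^+(e_{\mathcal{G}})=1$. $g$ is distinguishable if $g\ne e_{\mathcal{G}}$ and exactly one prime $P_{\min}(g)\mid g$ has norm $\mathrm{N}_-(g)$; $\mathfrak{D}(\mathcal{G},S)=\{g\text{ distinguishable}:P_{\min}(g)\in S\}\cup\{e_{\mathcal{G}}\}$. $Q_S(g)=\#\{P\in S:P\mid g,\ \|P\|=\mathrm{N}^+(g)\}$. $\mu$ is the Möbius function; $(\mu*a)(g)=\sum_{h\mid g}\mu(h)a(g/h)$; $a$ supported on $\mathfrak{D}(\mathcal{G},S)$ means it vanishes outside it. *)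

(* Defs.v *)
From HB Require Import structures.
From mathcomp Require Import all_boot all_order all_algebra.
From mathcomp Require Import all_classical all_reals all_analysis.
From mathcomp Require Import finmap multiset.
From mathcomp Require Export complex.
Import Order.TTheory GRing.Theory Num.Theory.
Import numFieldTopology.Exports numFieldNormedType.Exports.

Set Implicit Arguments.
Unset Strict Implicit.
Unset Printing Implicit Defensive.

Local Open Scope ring_scope.
Local Open Scope classical_set_scope.

(* The usual (modulus) metric topology on C = R[i]. *)
HB.instance Definition _ (R : rcfType) := PseudoPointedMetric.copy R[i] R[i]^o.

Definition toC (R : rcfType) (x : R) : R[i] := (x%:C)%C.
Definition cabs (R : rcfType) (z : R[i]) : R := ComplexField.Normc.normc z.

(* An arithmetical semigroup is (up to isomorphism) the free commutative
   monoid on its set of primes P, i.e. the monoid of finite multisets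
   multiset P under multiset sum, with identity the empty multiset; its
   multiplicative norm is determined by the norms nP p of the primes. *)
Section ArithSemigroup.
Variables (R : realType) (P : countType) (nP : P -> R).

Definition Gmul (h r : multiset P) : multiset P := (h `+` r)%mset.
Definition Gunit : multiset P := mset0.

Definition normG (g : multiset P) : R := \prod_(p <- g) nP p.

Definition dvdG (h g : multiset P) : Prop := exists r, g = Gmul h r.

Definition pdvdG (p : P) (g : multiset P) : Prop := dvdG (msetn 1 p) g.

Definition Nplus (g : multiset P) : R := \big[Num.max/1]_(p <- g) nP p.

(* N_-(g): minimal norm of a prime dividing g (for g <> e; value 1 at e,
   never used there) *)
Definition Nminus (g : multiset P) : R := \big[Num.min/Nplus g]_(p <- g) nP p.

Definition distinguishable (g : multiset P) : Prop :=
  g <> Gunit /\ exists! p, pdvdG p g /\ nP p = Nminus g.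

Definition Dset (S : set P) : set (multiset P) :=
  [set g | g = Gunit \/
           (distinguishable g /\
            exists p, [/\ pdvdG p g, nP p = Nminus g & S p])].

Definition QS (S : set P) (g : multiset P) : nat :=
  (\sum_(p \in [set p | S p /\ pdvdG p g /\ nP p = Nplus g]) 1)%N.

Definition mobius (g : multiset P) : R[i] :=
  if [forall p : finsupp g, g (val p) <= 1]%N then (- 1) ^+ size g else 0.

Definition mu_conv (a : multiset P -> R[i]) (g : multiset P) : R[i] :=
  \sum_(hr \in [set hr : multiset P * multiset P | g = Gmul hr.1 hr.2])
     mobius hr.1 * a hr.2.

Definition countG (x : R) : R := \sum_(g \in [set g | normG g <= x]) (1 : R).

Definition countP (S : set P) (x : R) : R :=
  \sum_(p \in [set p | S p /\ nP p <= x]) (1 : R).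

End ArithSemigroup.

Arguments Gunit {P}.
Arguments mobius {R P} g.

(* Main.v *)
(** For a prime q let b_q(d) = mu(d) if q is the unique prime divisor of d of
    least norm, and 0 otherwise.  Summing over the divisors d of g gives -1 if q
    is a prime divisor of g of greatest norm, and 0 otherwise, so that the sum in
    (i) is - sum_(q in S) f(||q||) sum_(||d|| <= x) b_q(d) N(x/||d||).  Replacing
    N(y) by c y turns this into -c x times the sum in (ii).  The error is o(x):
    for each q it involves sums of mu(m)/||m|| over m without small primes, which
    tend to 0, and the d free of primes of norm <= T have a density that
    vanishes as T grows because the product of the 1 - 1/||q|| diverges to 0.
    The sums in (ii) and (iii) differ by sum_(r <> e) a(r)/||r|| I_r(x/||r||),
    where each I_r tends to 0 and, by Mertens, I_r = O(1 + log log ||r||), so the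
    hypothesis on a allows dominated convergence.

    The analytic input is that m(x) = sum_(||g|| <= x) mu(g)/||g|| tends to 0, a
    form of the prime number theorem.  It follows Selberg: Axiom A gives
    H_2(x) = sum Lam_2(g)/||g|| = log^2 x + 2 b log x + O(1), where
    Lam_2 = Lam log + Lam * Lam, and
    |m(x)| log^2 x <= sum Lam_2(g)/||g|| |m(x/||g||)| + O(log x).
    Since int m(t) dt/t is bounded, m is small on a positive proportion of the
    logarithmic scale, and the inequality then lowers limsup |m| unless it is 0. *)

Require Import Defs.
From HB Require Import structures.
From mathcomp Require Import all_boot all_order all_algebra.
From mathcomp Require Import all_classical all_reals all_analysis.
From mathcomp Require Import finmap multiset complex.
From mathcomp Require Import ring lra zify.
Import Order.TTheory GRing.Theory Num.Theory.
Import numFieldTopology.Exports numFieldNormedType.Exports.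
Local Open Scope ring_scope.
Local Open Scope classical_set_scope.

Set Implicit Arguments.
Unset Strict Implicit.
Unset Printing Implicit Defensive.

(** * Real and complex preliminaries *)

(** Two uniformity problems shape the argument. The error in (i) is a sum over infinitely many
    primes q of quantities that tend to 0 with no common rate, and comparing (ii) with (iii)
    requires a bound on all I_r at once. For the first, Axiom A bounds the error at each d by a
    discounted weight exp (- (1 - eta) (u - log ||d||)) / ||d||, and each d has at most one least
    prime q, so all primes beyond T can be treated in bulk. For the second, the sieve bounds the sum
    of mu(g)/||g|| over the g composed of primes from an arbitrary set by a constant that does not
    depend on the set. No integral is formed: on the scale u = log x the integrals over [0, u] of
    the sum of 1/||g|| and of m are the sums weighted by u - log ||g||, and increments between u and
    v take the place of derivatives. The saving in Selberg's inequality depends only on a positive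
    lower bound for the limsup of |m|, so it is applied once, at the limsup itself. *)

Section Preliminaries.
Context (R : realType).
Implicit Types (u v : R).

Lemma exists_nat_gt (x : R) : exists n : nat, x < n%:R.
Proof.
by exists (Num.bound `|x|); rewrite (le_lt_trans (ler_norm x)) // archi_boundP.
Qed.

(* The hypothesis plays the role of [|W'(u)| <= A exp (- t u)]: subdividing
   [u, v] finely makes the quadratic error disappear, so no integral is needed. *)
Lemma conv_rate (W : R -> R) (t A K h : R) : 0 < t -> 0 <= A -> 0 <= K -> 0 < h ->
  (forall u v, 0 <= u -> u <= v -> v <= u + h ->
     `|W v - W u| <= (A * expR (- t * u) + K * (v - u)) * (v - u)) ->
  exists k, forall u, 0 <= u -> `|W u - k| <= A / (1 - expR (- t)) * expR (- t * u).
Proof.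
move=> t0 A0 K0 h0 HW.
have q1 : expR (- t) < 1 by rewrite expR_lt1 oppr_lt0.
have step1 u v : 0 <= u -> u <= v -> `|W v - W u| <= A * expR (- t * u) * (v - u).
  move=> u0 uv; apply/ler_addgt0Pr => e e0.
  have vu0 : 0 <= v - u by rewrite subr_ge0.
  have [n] := exists_nat_gt (Num.max 0 (Num.max ((v - u) / h) (K * (v - u) ^+ 2 / e))).
  rewrite !gt_max => /and3P[n0 /ltW n1 /ltW n2].
  pose d := (v - u) / n%:R.
  have d0 : 0 <= d by rewrite divr_ge0 // ltW.
  have dh : d <= h by rewrite /d ler_pdivrMr // -ler_pdivrMl // mulrC.
  have dn : d * n%:R = v - u by rewrite /d divfK // gt_eqF.
  have step (m : nat) : `|W (u + d * m%:R) - W u| <= m%:R * ((A * expR (- t * u) + K * d) * d).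
    elim: m => [|m IH]; first by rewrite mulr0 addr0 subrr normr0 mul0r.
    have -> : W (u + d * m.+1%:R) - W u = (W (u + d * m.+1%:R) - W (u + d * m%:R)) +
       (W (u + d * m%:R) - W u) by ring.
    apply: (le_trans (ler_normD _ _)); rewrite -natr1 mulrDl mul1r addrC lerD //.
    have m0 : 0 <= d * m%:R by rewrite mulr_ge0.
    have := HW (u + d * m%:R) (u + d * (m%:R + 1)).
    have -> : u + d * (m%:R + 1) - (u + d * m%:R) = d by ring.
    move=> /(_ (addr_ge0 u0 m0)) H; apply: (le_trans (H _ _)).
    - by rewrite mulrDr mulr1 addrA lerDl.
    - by rewrite mulrDr mulr1 addrA lerD2l.
    rewrite ler_wpM2r // lerD2r ler_wpM2l // ler_expR mulrDr gerDl.
    by rewrite mulNr oppr_le0 mulr_ge0 // ltW.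
  have := step n; rewrite dn subrKC => /le_trans; apply.
  have -> : n%:R * ((A * expR (- t * u) + K * d) * d) =
      A * expR (- t * u) * (d * n%:R) + K * d * (d * n%:R) by ring.
  rewrite dn lerD2l /d.
  have -> : K * ((v - u) / n%:R) * (v - u) = K * (v - u) ^+ 2 / n%:R by ring.
  by rewrite ler_pdivrMr // [e * _]mulrC -ler_pdivrMr.
(* One unit to the right at a time: A / (1 - exp (- t)) is the solution B of B = A + B exp (- t),
   the geometric series of the unit steps. *)
have step2 (n : nat) : forall u v, 0 <= u -> u <= v -> v <= u + n%:R ->
    `|W v - W u| <= A / (1 - expR (- t)) * expR (- t * u).
  have B0 : 0 <= A / (1 - expR (- t)) by rewrite divr_ge0 // subr_ge0 ltW.
  elim: n => [|n IH] u v u0 uv vn.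
    have -> : v = u by apply/eqP; rewrite eq_le uv andbT -(addr0 u).
    by rewrite subrr normr0 mulr_ge0 ?expR_ge0.
  have E : A / (1 - expR (- t)) * expR (- t * u) = A * expR (- t * u) +
      A / (1 - expR (- t)) * expR (- t * (u + 1)).
    by rewrite mulrDr mulr1 expRD; field; rewrite subr_eq0 eq_sym lt_eqF.
  case: (leP v (u + 1)) => v1.
    apply: (le_trans (step1 _ _ u0 uv)); apply: (@le_trans _ _ (A * expR (- t * u))).
      by rewrite ler_piMr ?mulr_ge0 ?expR_ge0 // lerBlDl.
    by rewrite E lerDl mulr_ge0 ?expR_ge0.
  have -> : W v - W u = (W (u + 1) - W u) + (W v - W (u + 1)) by ring.
  apply: (le_trans (ler_normD _ _)); rewrite E lerD //.
    apply: (le_trans (step1 _ _ u0 _)); first by rewrite lerDl.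
    by rewrite addrC addKr mulr1.
  apply: IH => //; first by rewrite addr_ge0.
    exact: ltW.
  by rewrite -addrA [1 + _]addrC natr1.
have step3 u v : 0 <= u -> u <= v ->
    `|W v - W u| <= A / (1 - expR (- t)) * expR (- t * u).
  move=> u0 uv; have [k uk] := exists_nat_gt (v - u).
  by apply: (step2 k) => //; rewrite -lerBlDl ltW.
pose B := A / (1 - expR (- t)).
(* The limit is the supremum of the lower bounds W u - B exp (- t u); by [step3] each of them lies
   below every W v + B exp (- t v). *)
pose X := [set W u - B * expR (- t * u) | u in [set u | 0 <= u]].
have ubX v : 0 <= v -> ubound X (W v + B * expR (- t * v)).
  move=> v0 _ [u /= u0 <-]; case: (leP u v) => uv.
    have := step3 _ _ u0 uv; rewrite ler_norml -/B => /andP[+ _].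
    have : 0 <= B * expR (- t * v).
      by rewrite mulr_ge0 ?expR_ge0 // divr_ge0 // subr_ge0 ltW.
    lra.
  have := step3 _ _ v0 (ltW uv); rewrite ler_norml -/B => /andP[_].
  have : 0 <= B * expR (- t * u).
    by rewrite mulr_ge0 ?expR_ge0 // divr_ge0 // subr_ge0 ltW.
  lra.
exists (sup X) => u u0; rewrite ler_distlC; apply/andP; split.
  apply: ub_le_sup; last by exists u.
  by exists (W 0 + B * expR (- t * 0)); apply: ubX.
by apply: ge_sup; [exists (W u - B * expR (- t * u)), u|exact: ubX].
Qed.

Lemma expRN_bounds (d : R) : 0 <= d -> d <= 2^-1 ->
  [/\ d - d ^+ 2 <= 1 - expR (- d), 1 - expR (- d) <= d &
      expR d - 1 <= d + 2 * d ^+ 2].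
Proof.
move=> d0 d1; have H1 : 1 - d <= expR (- d) by exact: expR_ge1Dx.
have H2 : 1 + d <= expR d by exact: expR_ge1Dx.
have H3 : expR d * expR (- d) = 1 by rewrite -expRD subrr expR0.
have p1 := expR_gt0 d; have p2 := expR_gt0 (- d).
split; nra.
Qed.

Lemma poly_expR (t : R) : 0 < t -> exists K : R, 0 <= K /\ forall v, 0 <= v ->
  (1 + v) ^+ 2 * expR (- t * v) <= K * expR (- (t / 2) * v).
Proof.
(* This s gives s (1 + v) <= 1 + t v / 4 <= exp (t v / 4); squaring costs half of the decay rate. *)
move=> t0; pose s := Num.min 1 (t / 4).
have s0 : 0 < s by rewrite lt_min ltr01 divr_gt0.
exists (s ^- 2); split; first by rewrite invr_ge0 exprn_ge0 // ltW.
move=> v v0; rewrite ler_pdivlMl ?exprn_gt0 //.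
have -> : expR (- (t / 2) * v) = expR (t / 4 * v) ^+ 2 * expR (- t * v).
  by rewrite expr2 -!expRD; congr expR; field.
rewrite mulrA ler_wpM2r ?expR_ge0 // -exprMn ler_sqr ?nnegrE ?expR_ge0 //; last first.
  by rewrite mulr_ge0 ?addr_ge0 // ltW.
apply: le_trans (expR_ge1Dx _).
have s1 : s <= 1 by rewrite ge_min lexx.
have s2 : s <= t / 4 by rewrite ge_min lexx orbT.
rewrite mulrDr mulr1 lerD // ler_wpM2r //.
Qed.

Lemma expR_small (A t e : R) : 0 <= A -> 0 < t -> 0 < e ->
  exists u0 : R, 0 <= u0 /\ forall u, u0 <= u -> A * expR (- t * u) <= e.
Proof.
move=> A0 t0 e0; exists (A / (e * t)); split.
  by rewrite divr_ge0 // mulr_ge0 // ltW.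
move=> u; rewrite ler_pdivrMr ?mulr_gt0 // => uA.
rewrite mulNr expRN ler_pdivrMr ?expR_gt0 //.
have := expR_ge1Dx (t * u).
have : e * (1 + t * u) <= e * expR (t * u) by rewrite ler_wpM2l ?expR_ge1Dx // ltW.
nra.
Qed.

Lemma block_index (x Q : R) : 0 <= x -> 0 < Q ->
  exists n : nat, n%:R * Q <= x /\ x < n%:R * Q + Q.
Proof.
move=> x0 Q0; have [N] := exists_nat_gt (x / Q); rewrite ltr_pdivrMr //.
elim: N => [|N IH]; first by rewrite mul0r ltNge x0.
rewrite -natr1 mulrDl mul1r; case: (ltP x (N%:R * Q)) => [/IH//|h1 h2].
by exists N.
Qed.

(* In every block of length L + h there is a window of length h on which M is
   at most al / 2, and there S2 has a positive proportion of its increase. *)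
Lemma Selberg_descent (M S2 : R -> R) (X : R -> R -> R) (b K K2 K7 L h u0 al : R) :
  0 <= K -> 0 <= K2 -> 0 <= K7 -> 0 < L -> 0 < h -> 0 <= u0 -> 0 < al ->
  (forall u, 0 <= u -> `|S2 u - u ^+ 2 - b * u| <= K) ->
  (forall u, 0 <= S2 u) -> (forall u v, u <= v -> S2 u <= S2 v) ->
  (forall u, M u <= K2) ->
  (forall u y, X u y <= K2 * S2 y) ->
  (forall u x y a : R, x <= y -> (forall t, u - y <= t -> t < u - x -> M t <= a) ->
     X u y - X u x <= a * (S2 y - S2 x)) ->
  (forall u, 0 <= u -> M u * u ^+ 2 <= X u u + K7 * (1 + u)) ->
  (forall u, u0 <= u -> exists t, [/\ u <= t, t <= u + L &
     forall t', t <= t' -> t' <= t + h -> M t' <= al / 2]) ->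
  exists ka : R, 0 < ka /\ forall al' : R, al <= al' ->
    (exists u1 : R, forall u, u1 <= u -> M u <= al') ->
    exists u2 : R, forall u, u2 <= u -> M u <= al' - ka.
Proof.
move=> K0 K20 K70 L0 h0 u00 al0 HS H2ge0 H2mono HK2 X_le Xle HK7 HL.
pose Q := L + h; have Q0 : 0 < Q by rewrite addr_gt0.
have EQ : Q = L + h by [].
(* Past [y0] a window carries at least h y of the increase of S2 and its block at most 3 Q y.
   Replacing al' by al / 2 on the window saves at least al / 2 there, hence [kp] on average over the
   block. *)
pose kp := al * h / (6 * Q).
have kp0 : 0 < kp by apply: divr_gt0; [exact: mulr_gt0|lra].
have kpQ : kp * (3 * Q) = al / 2 * h by rewrite /kp; field; rewrite gt_eqF.
have kpal : kp <= al.
  rewrite /kp ler_pdivrMr ?mulr_gt0 // ler_pM2l // /Q; lra.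
clearbody kp.
clearbody Q.
exists (kp / 2); split; first by rewrite divr_gt0.
(* [kp] is already fixed from al alone: the same saving serves every bound al' >= al. *)
move=> al' al_le [u1 Hu1].
pose B0 := Num.max u0 u1.
have [B1 B2] : u0 <= B0 /\ u1 <= B0 by rewrite /B0 !le_max !lexx ?orbT.
have B00 : 0 <= B0 by apply: le_trans B1.
clearbody B0.
pose y0 := Num.max ((2 * K + h * `|b|) / h) (Q + `|b| + 2 * K / Q).
have y0h (y : R) : y0 <= y -> h * y <= 2 * h * y - h * `|b| - 2 * K.
  rewrite /y0 ge_max ler_pdivrMr // => /andP[+ _]; lra.
have y0Q (y : R) : y0 <= y -> 2 * Q * y + Q ^+ 2 + Q * `|b| + 2 * K <= 3 * Q * y.
  rewrite /y0 ge_max => /andP[_ H1].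
  have : Q * (Q + `|b| + 2 * K / Q) <= Q * y by rewrite ler_pM2l.
  have -> : Q * (Q + `|b| + 2 * K / Q) = Q ^+ 2 + Q * `|b| + 2 * K.
    by field; rewrite gt_eqF.
  lra.
have y00 : 0 <= y0.
  rewrite /y0 le_max; apply/orP; left; apply: divr_ge0; last exact: ltW.
  by apply: addr_ge0; apply: mulr_ge0 => //; exact: ltW.
clearbody y0.
have H2up (x y : R) : 0 <= x -> x <= y ->
    S2 y - S2 x <= y ^+ 2 - x ^+ 2 + `|b| * (y - x) + 2 * K.
  move=> x0 xy; have := HS _ x0; have := HS _ (le_trans x0 xy).
  rewrite !ler_norml => /andP[_ a1] /andP[a2 _].
  have : b * (y - x) <= `|b| * (y - x) by rewrite ler_wpM2r ?ler_norm // subr_ge0.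
  lra.
have H2lo (x y : R) : 0 <= x -> x <= y ->
    y ^+ 2 - x ^+ 2 - `|b| * (y - x) - 2 * K <= S2 y - S2 x.
  move=> x0 xy; have := HS _ x0; have := HS _ (le_trans x0 xy).
  rewrite !ler_norml => /andP[a1 _] /andP[_ a2].
  have : (- b) * (y - x) <= `|b| * (y - x).
    by rewrite ler_wpM2r ?subr_ge0 // -normrN ler_norm.
  lra.
have block (u y : R) : y0 <= y -> y + Q <= u - B0 ->
    X u (y + Q) - X u y <= (al' - kp) * (S2 (y + Q) - S2 y).
  move=> yy0 yu; have y_0 : 0 <= y by apply: le_trans yy0.
  have [|t [t1 t2 t3]] := HL (u - y - Q); first by lra.
  (* M is evaluated at u minus the summation variable, so the window [t, t + h] for M is the window
     [z, z + h] for S2. *)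
  pose z := u - t - h.
  have Ez : z = u - t - h by [].
  clearbody z; have [z1 z2] : y <= z /\ z + h <= y + Q by clear -EQ Ez t1 t2; split; lra.
  have m1 (t' : R) : u - (y + Q) <= t' -> M t' <= al' by move=> ?; apply: Hu1; lra.
  have a1 : X u z - X u y <= al' * (S2 z - S2 y).
    by apply: Xle => // t' ? _; apply: m1; lra.
  have a3 : X u (y + Q) - X u (z + h) <= al' * (S2 (y + Q) - S2 (z + h)).
    by apply: Xle => // t' ? _; apply: m1; lra.
  have a2 : X u (z + h) - X u z <= al / 2 * (S2 (z + h) - S2 z).
    apply: Xle => [|t' t1' t2']; first by rewrite lerDl ltW.
    by apply: t3; clear -Ez t1' t2'; lra.
  have zh : h * y <= S2 (z + h) - S2 z.
    apply: le_trans (H2lo _ _ (le_trans y_0 z1) _); last by rewrite lerDl ltW.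
    have e1 := y0h z (le_trans yy0 z1).
    have e2 : h * y <= h * z by rewrite ler_pM2l.
    have e3 := sqr_ge0 h; clear -e1 e2 e3; lra.
  have yQ : S2 (y + Q) - S2 y <= 3 * Q * y.
    apply: (le_trans (H2up _ _ y_0 _)); first by rewrite lerDl ltW.
    have e1 := y0Q y yy0; clear -e1; lra.
  have s1 : kp * (S2 (y + Q) - S2 y) <= kp * (3 * Q * y) by rewrite ler_pM2l.
  have s2 : al / 2 * (h * y) <= al / 2 * (S2 (z + h) - S2 z).
    by rewrite ler_wpM2l // divr_ge0 // ltW.
  have s3 : 0 <= (al' - al) * (S2 (z + h) - S2 z).
    apply: mulr_ge0; first by rewrite subr_ge0.
    by apply: le_trans zh; rewrite mulr_ge0 // ltW.
  have s4 : kp * (3 * Q * y) = al / 2 * (h * y).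
    by rewrite [3 * Q * y]mulrC mulrCA kpQ; ring.
  clear -a1 a2 a3 s1 s2 s3 s4; lra.
have blocks (u : R) (n : nat) : y0 + n%:R * Q <= u - B0 ->
    X u (y0 + n%:R * Q) - X u y0 <= (al' - kp) * (S2 (y0 + n%:R * Q) - S2 y0).
  elim: n => [|n IH]; first by rewrite mul0r addr0 !subrr mulr0.
  rewrite -natr1 mulrDl mul1r addrA => Hn.
  have := block u (y0 + n%:R * Q); rewrite lerDl mulr_ge0 ?(ltW Q0) //.
  move=> /(_ isT Hn) e1; have /IH e2 : y0 + n%:R * Q <= u - B0.
    by clear -Hn Q0; lra.
  clear -e1 e2; lra.
pose D := B0 + Q; have ED : D = B0 + Q by [].
clearbody D.
(* Collects what is O(1 + u): the segment up to [y0], the last segment of length at most D, where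
   al' is not yet available or no full block fits, and the linear part of S2. *)
pose K9 := K7 + K2 * S2 y0 + K2 * (2 * D + `|b| * D + 2 * K) + al' * (`|b| + K).
have K90 : 0 <= K9.
  have D0 : 0 <= D by rewrite ED; apply: addr_ge0 => //; exact: ltW.
  have al'0 : 0 <= al' by apply: le_trans al_le; exact: ltW.
  have w1 : 0 <= K2 * S2 y0 by rewrite mulr_ge0.
  have w2 : 0 <= K2 * D by rewrite mulr_ge0.
  have w3 : 0 <= K2 * (`|b| * D) by rewrite !mulr_ge0.
  have w4 : 0 <= K2 * K by rewrite !mulr_ge0.
  have w5 : 0 <= al' * `|b| by rewrite !mulr_ge0.
  have w6 : 0 <= al' * K by rewrite !mulr_ge0.
  rewrite /K9; clear -w1 w2 w3 w4 w5 w6 K70; lra.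
have EK9 : K9 = K7 + K2 * S2 y0 + K2 * (2 * D + `|b| * D + 2 * K) + al' * (`|b| + K) by [].
clearbody K9.
have main (u : R) : B0 + y0 <= u -> M u * u ^+ 2 <= (al' - kp) * u ^+ 2 + K9 * (1 + u).
  move=> uB; have u_0 : 0 <= u by apply: le_trans uB; rewrite addr_ge0.
  have [|n [n1 n2]] := @block_index (u - B0 - y0) Q _ Q0; first by lra.
  pose y1 := y0 + n%:R * Q.
  have [y1a y1b] : y1 <= u - B0 /\ u - D < y1 by rewrite /y1; clear -n1 n2 ED; split; lra.
  have y10 : 0 <= y1 by rewrite addr_ge0 ?mulr_ge0 // ltW.
  have := HK7 _ u_0 => h1.
  have := blocks u n y1a; rewrite -/y1 => h2; clearbody y1.
  have h3 : X u u - X u y1 <= K2 * (S2 u - S2 y1).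
    by apply: Xle => [|t _ _]; [clear -y1a B00; lra|exact: HK2].
  have h4 := X_le u y0.
  have h5 : S2 u - S2 y1 <= 2 * D * u + `|b| * D + 2 * K.
    apply: (le_trans (H2up _ _ y10 _)); first by clear -y1a B00; lra.
    have e1 : `|b| * (u - y1) <= `|b| * D by rewrite ler_wpM2l //; clear -y1b; lra.
    have e2 : (u - y1) * (u + y1) <= D * (2 * u).
      clear -y1a y1b y10 u_0 B00; apply: ler_pM; [lra|exact: addr_ge0|lra|lra].
    clear -e1 e2; lra.
  have h6 : K2 * (S2 u - S2 y1) <= K2 * (2 * D * u + `|b| * D + 2 * K) by rewrite ler_wpM2l.
  have akp : 0 <= al' - kp by clear -al_le kpal; lra.
  have h7 : (al' - kp) * (S2 y1 - S2 y0) <= (al' - kp) * (u ^+ 2 + `|b| * u + K).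
    rewrite ler_wpM2l //; have e1 := H2ge0 y0.
    have e2 : S2 y1 <= S2 u by apply: H2mono; clear -y1a B00; lra.
    have := HS _ u_0; rewrite ler_norml => /andP[_ e3].
    have e4 : b * u <= `|b| * u by rewrite ler_wpM2r ?ler_norm.
    clear -e1 e2 e3 e4; lra.
  have h8 : (al' - kp) * (`|b| * u + K) <= al' * (`|b| * u + K).
    by rewrite ler_wpM2r ?addr_ge0 ?mulr_ge0 // gerBl ltW.
  have al'0 : 0 <= al' by apply: le_trans al_le; exact: ltW.
  have D0 : 0 <= D by rewrite ED; apply: addr_ge0 => //; exact: ltW.
  have w1 : 0 <= K2 * S2 y0 * u by rewrite !mulr_ge0.
  have w2 : 0 <= K2 * D by rewrite !mulr_ge0.
  have w3 : 0 <= K2 * (`|b| * D) * u by rewrite !mulr_ge0.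
  have w4 : 0 <= K2 * K * u by rewrite !mulr_ge0.
  have w5 : 0 <= al' * `|b| by rewrite !mulr_ge0.
  have w6 : 0 <= al' * K * u by rewrite !mulr_ge0.
  rewrite EK9; clear -h1 h2 h3 h4 h6 h7 h8 w1 w2 w3 w4 w5 w6 K70; lra.
(* From here on K9 (1 + u) <= 2 K9 u <= kp u^2 / 2, so half of [kp] survives. *)
exists (Num.max (B0 + y0) (1 + 4 * K9 / kp)) => u.
rewrite ge_max => /andP[/main hm hu].
have u1' : 1 <= u.
  by apply: le_trans hu; rewrite lerDl; apply: divr_ge0; [exact: mulr_ge0|exact: ltW].
have ku : 4 * K9 <= kp * u.
  by rewrite [kp * u]mulrC -ler_pdivrMr //; clear -hu; lra.
have u_gt0 : 0 < u by apply: lt_le_trans u1'.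
have u2 : 0 < u ^+ 2 by rewrite exprn_gt0.
rewrite -(ler_pM2r u2); apply: (le_trans hm).
have e1 : K9 * (1 + u) <= K9 * (2 * u) by rewrite ler_wpM2l //; clear -u1'; lra.
have e2 : 4 * K9 * u <= kp * u * u by rewrite ler_pM2r.
rewrite expr2; clear -e1 e2; lra.
Qed.

(** Convergence to 0 in epsilon form, for functions of u = log x; [cvgC_expR] translates it into
    limits of functions of x. *)
Definition to0 (f : R -> R) := forall e : R, 0 < e ->
  exists u0 : R, forall u, u0 <= u -> `|f u| <= e.

(** Taking limsups in the recursion gives limsup B <= a + exp (- t) limsup B; n iterations leave a
    remainder K exp (- t n). Used with l = t to delete a prime and with l = 1 for discounted
    sums. *)
Lemma limsup_contraction (B : R -> R) (a t l K : R) :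
  0 < t -> 0 <= K -> 0 <= a -> (forall u, B u <= K) ->
  (forall e : R, 0 < e -> exists u0 : R, forall u, u0 <= u ->
     B u <= a + e + expR (- t) * B (u - l)) ->
  forall e : R, 0 < e -> exists u0 : R, forall u, u0 <= u ->
     B u <= a / (1 - expR (- t)) + e.
Proof.
move=> t0 K0 a0 BK Hrec e e0.
have q1 : 0 < 1 - expR (- t) by rewrite subr_gt0 expR_lt1 oppr_lt0.
pose e1 := e / 2 * (1 - expR (- t)).
have e10 : 0 < e1 by rewrite mulr_gt0 // divr_gt0.
have [u0 Hu0] := Hrec _ e10.
have claim (n : nat) : exists v : R, forall u, v <= u ->
    B u <= (a + e1) / (1 - expR (- t)) + K * expR (- t * n%:R).
  elim: n => [|n [v Hv]].
    exists 0 => u _; rewrite mulr0 expR0 mulr1 (le_trans (BK u)) // lerDr.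
    by apply: divr_ge0; [apply: addr_ge0 => //; exact: ltW|exact: ltW].
  exists (Num.max u0 (v + l)) => u; rewrite ge_max => /andP[/Hu0 h1 h2].
  apply: (le_trans h1); have := Hv (u - l); rewrite lerBrDr => /(_ h2) h3.
  have h4 := ler_wpM2l (expR_ge0 (- t)) h3; move: h4.
  rewrite mulrDr [_ * (K * _)]mulrCA -expRD.
  have -> : - t + - t * n%:R = - t * n.+1%:R by rewrite -natr1; ring.
  move=> h4; have -> : (a + e1) / (1 - expR (- t)) =
    a + e1 + expR (- t) * ((a + e1) / (1 - expR (- t))) by field; rewrite gt_eqF.
  by rewrite -[leRHS]addrA lerD2l.
have e2 : 0 < e / 2 by rewrite divr_gt0.
have [v [v0 Hv]] := expR_small K0 t0 e2.
have [n /ltW vn] := exists_nat_gt v.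
have [w Hw] := claim n; exists w => u /Hw /le_trans; apply.
have := Hv _ vn.
have -> : (a + e1) / (1 - expR (- t)) = a / (1 - expR (- t)) + e / 2.
  by rewrite /e1; field; rewrite gt_eqF.
lra.
Qed.

Lemma to0_ext (f f' : R -> R) : (forall u, 0 <= u -> f u = f' u) -> to0 f -> to0 f'.
Proof.
move=> E H e /H[u0 Hu0]; exists (Num.max 0 u0) => u.
by rewrite ge_max => /andP[u_0 /Hu0]; rewrite E.
Qed.

Lemma to0D (f f' : R -> R) : to0 f -> to0 f' -> to0 (fun u => f u + f' u).
Proof.
move=> H H' e e0; have e2 : 0 < e / 2 by rewrite divr_gt0.
have [u0 Hu0] := H _ e2; have [u1 Hu1] := H' _ e2.
exists (Num.max u0 u1) => u; rewrite ge_max => /andP[/Hu0 h /Hu1 h'].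
by rewrite [e]splitr (le_trans (ler_normD _ _)) // lerD.
Qed.

Lemma to0Z (k : R) (f : R -> R) : to0 f -> to0 (fun u => k * f u).
Proof.
move=> H e e0; have e2 : 0 < e / (1 + `|k|) by rewrite divr_gt0 // ltr_pwDl.
have [u0 Hu0] := H _ e2; exists u0 => u /Hu0; rewrite ler_pdivlMr ?ltr_pwDl //.
rewrite normrM; have := normr_ge0 (f u); lra.
Qed.

Lemma to0_shift (l : R) (f : R -> R) : to0 f -> to0 (fun u => f (u - l)).
Proof.
move=> H e /H[u0 Hu0]; exists (u0 + l) => u; rewrite -lerBrDr; exact: Hu0.
Qed.

Lemma to0_norm (f : R -> R) : to0 f -> to0 (fun u => `|f u|).
Proof. by move=> H e /H[u0 Hu0]; exists u0 => u /Hu0; rewrite normr_id. Qed.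

Lemma to0_le (f f' : R -> R) : (forall u, `|f' u| <= f u) -> to0 f -> to0 f'.
Proof.
move=> ff H e /H[u0 Hu0]; exists u0 => u /Hu0; apply: le_trans.
by rewrite (le_trans (ff u)) // ler_norm.
Qed.

Lemma to0_sum (T : Type) (s : seq T) (F : T -> R -> R) :
  (forall i, to0 (F i)) -> to0 (fun u => \sum_(i <- s) F i u).
Proof.
move=> HF; elim: s => [|i s IH].
  by move=> e e0; exists 0 => u _; rewrite big_nil normr0 ltW.
apply: (@to0_ext (fun u => F i u + \sum_(i <- s) F i u)).
  by move=> u _; rewrite big_cons.
exact: to0D.
Qed.

Lemma ler_sum_sub (T : eqType) (s1 s2 : seq T) (F : T -> R) : uniq s1 -> uniq s2 ->
  {subset s1 <= s2} -> (forall x, 0 <= F x) -> \sum_(x <- s1) F x <= \sum_(x <- s2) F x.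
Proof.
move=> u1 u2 s12 F0; rewrite [leRHS](bigID (mem s1)) /=.
have -> : \sum_(x <- s1) F x = \sum_(x <- s2 | x \in s1) F x.
  rewrite -[RHS]big_filter; apply: perm_big; apply: uniq_perm; rewrite ?filter_uniq //.
  by move=> x; rewrite mem_filter; case: (boolP (x \in s1)) => // /s12 ->.
by rewrite lerDl sumr_ge0.
Qed.

(** * Complex values and limits along x = exp u *)

Lemma cabs0 : cabs (0 : R[i]) = 0.
Proof. exact: ComplexField.Normc.normc0. Qed.

Lemma cabsM (x y : R[i]) : cabs (x * y) = cabs x * cabs y.
Proof. exact: ComplexField.Normc.normcM. Qed.

Lemma cabsD (x y : R[i]) : cabs (x + y) <= cabs x + cabs y.
Proof. exact: le_normcD. Qed.

Lemma cabs_toC (x : R) : cabs (toC x) = `|x|.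
Proof. by rewrite /cabs /toC /= expr0n /= addr0 sqrtr_sqr. Qed.

Lemma cabs_ge0 (x : R[i]) : 0 <= cabs x.
Proof. by case: x => a b; exact: sqrtr_ge0. Qed.

Lemma cabs_sum (T : Type) (s : seq T) (A : pred T) (F : T -> R[i]) :
  cabs (\sum_(i <- s | A i) F i) <= \sum_(i <- s | A i) cabs (F i).
Proof.
elim/big_ind2: _ => [|x a y b h1 h2|//]; first by rewrite cabs0.
by rewrite (le_trans (cabsD _ _)) // lerD.
Qed.

Lemma toCM (x y : R) : toC (x * y) = toC x * toC y.
Proof. exact: (rmorphM (@complex.real_complex_def R (Phant R))). Qed.

Lemma toCD (x y : R) : toC (x + y) = toC x + toC y.
Proof. exact: (rmorphD (@complex.real_complex_def R (Phant R))). Qed.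

Lemma toCN (x : R) : toC (- x) = - toC x.
Proof. exact: (rmorphN (@complex.real_complex_def R (Phant R))). Qed.

Lemma toC_nat (n : nat) : toC (n%:R : R) = n%:R.
Proof. exact: (rmorph_nat (@complex.real_complex_def R (Phant R))). Qed.

Lemma toCV (x : R) : toC x^-1 = (toC x)^-1.
Proof. exact: (fmorphV (@complex.real_complex_def R (Phant R))). Qed.

Lemma toC_sum (T : Type) (s : seq T) (F : T -> R) :
  toC (\sum_(i <- s) F i) = \sum_(i <- s) toC (F i).
Proof. exact: (rmorph_sum (@complex.real_complex_def R (Phant R))). Qed.

Lemma normC_cabs (z : R[i]) : `|z| = toC (cabs z).
Proof. by case: z => x y; rewrite normc_def. Qed.

Lemma cvgC_expR (F : R -> R[i]) (l : R[i]) :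
  F x @[x --> +oo] --> l <-> to0 (fun u => cabs (F (expR u) - l)).
Proof.
have dist := @cvgrPdist_le R[i] R[i]^o R (pinfty_nbhs R) _ F l.
split=> [/dist Hc e e0|Hc].
  have /Hc[M [Mr HM]] : 0 < toC e :> R[i] by rewrite ltcR.
  exists M => u Mu; have : M < expR u.
    by apply: lt_le_trans (expR_ge1Dx u); rewrite (le_lt_trans Mu) // ltrDr.
  move/HM; rewrite /= distrC normC_cabs lecR.
  by rewrite ger0_norm // cabs_ge0.
apply/dist => e e0.
(* A positive element of R[i] is real, hence equal to its modulus. *)
have ee : e = toC (cabs e) by rewrite -normC_cabs gtr0_norm.
have e1 : 0 < cabs e by move: e0; rewrite {1}ee ltcR.
have [u0 Hu0] := Hc _ e1.
exists (expR u0); split; first exact: num_real.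
move=> x /= ux; have x0 : 0 < x by apply: lt_trans ux; exact: expR_gt0.
have xE : x = expR (ln x) by rewrite lnK.
have := Hu0 (ln x); rewrite -ler_expR -xE => /(_ (ltW ux)).
rewrite ger0_norm ?cabs_ge0 // => h.
by rewrite distrC normC_cabs ee lecR.
Qed.

Lemma to0_lin (F A B : R -> R[i]) (k1 k2 : R[i]) :
  (forall u, F u = k1 * A u + k2 * B u) ->
  to0 (fun u => cabs (A u)) -> to0 (fun u => cabs (B u)) -> to0 (fun u => cabs (F u)).
Proof.
move=> E HA' HB'; apply: to0_le (to0D (to0Z (cabs k1) HA') (to0Z (cabs k2) HB')) => u.
by rewrite ger0_norm ?cabs_ge0 // E (le_trans (cabsD _ _)) // !cabsM.
Qed.

End Preliminaries.

(** * Arithmetical functions on the semigroup *)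

Section Semigroup.

Context (R : realType) (P : countType) (nP : P -> R).
Hypothesis nP_gt1 : forall p, 1 < nP p.
Hypothesis finN : forall x : R, finite_set [set g | normG nP g <= x].
Local Notation G := (multiset P).
Implicit Types (g h : G) (p q : P) (u : R).

Lemma perm_msetD g h : perm_eq (msetD g h) (enum_mset g ++ enum_mset h).
Proof.
rewrite /perm_eq; apply/allP => p _ /=; apply/eqP.
by rewrite count_cat !count_mem_mset msetE2.
Qed.

Lemma normG0 : normG nP mset0 = 1.
Proof. by rewrite /normG enum_mset0 big_nil. Qed.

Lemma normG1 p : normG nP [mset p]%mset = nP p.
Proof. by rewrite /normG enum_msetn big_seq1. Qed.

Lemma normGD g h : normG nP (msetD g h) = normG nP g * normG nP h.
Proof. by rewrite /normG (perm_big _ (perm_msetD g h)) big_cat. Qed.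

Lemma normG_ge1 g : 1 <= normG nP g.
Proof.
rewrite /normG; elim: (enum_mset g) => [|p s IH]; first by rewrite big_nil.
by rewrite big_cons mulr_ege1 // ltW.
Qed.

Lemma normG_gt0 g : 0 < normG nP g.
Proof. exact: lt_le_trans (normG_ge1 g). Qed.

(* All sums run over [lg g <= u], that is [||g|| <= exp u]: products of norms
   become sums and [1 / ||g||] becomes the weight [wt g]. *)
Definition lg g : R := ln (normG nP g).

Definition wt g : R := expR (- lg g).

Lemma lg0 : lg mset0 = 0. Proof. by rewrite /lg normG0 ln1. Qed.

Lemma lgD g h : lg (msetD g h) = lg g + lg h.
Proof. by rewrite /lg normGD lnM ?posrE ?normG_gt0. Qed.

Lemma lg_ge0 g : 0 <= lg g. Proof. by rewrite ln_ge0 ?normG_ge1. Qed.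

Lemma expR_lg g : expR (lg g) = normG nP g.
Proof. by rewrite lnK // posrE normG_gt0. Qed.

Lemma wtE g : wt g = (normG nP g)^-1.
Proof. by rewrite /wt expRN expR_lg. Qed.

Lemma wt_ge0 g : 0 <= wt g. Proof. exact: expR_ge0. Qed.

Lemma wt0 : wt mset0 = 1. Proof. by rewrite /wt lg0 oppr0 expR0. Qed.

Lemma wtD g h : wt (msetD g h) = wt g * wt h.
Proof. by rewrite /wt lgD opprD expRD. Qed.

Lemma lg1_gt0 p : 0 < lg [mset p]%mset.
Proof. by rewrite /lg normG1 ln_gt0. Qed.

Definition gle u : {fset G} := fset_set [set g | lg g <= u].

Lemma lg_le u g : (lg g <= u) = (normG nP g <= expR u).
Proof. by rewrite -expR_lg ler_expR. Qed.

Lemma finL u : finite_set [set g | lg g <= u].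
Proof.
suff -> : [set g | lg g <= u] = [set g | normG nP g <= expR u] by [].
by apply/seteqP; split=> g /=; rewrite lg_le.
Qed.

Lemma mem_gle u g : (g \in gle u) = (lg g <= u).
Proof. rewrite in_fset_set; last exact: finL.
by apply/idP/idP => [/set_mem|/mem_set]. Qed.

Lemma gle_neg u : u < 0 -> gle u = fset0.
Proof.
move=> u0; apply/fsetP => g; rewrite mem_gle inE; apply/negbTE.
by rewrite -ltNge (lt_le_trans u0) ?lg_ge0.
Qed.

(** * Finite sums over ||g|| <= exp u *)

Definition bsum (V : zmodType) u (F : G -> V) : V := \sum_(g <- gle u) F g.

Lemma eq_bsum (V : zmodType) u (F F' : G -> V) :
  (forall g, lg g <= u -> F g = F' g) -> bsum u F = bsum u F'.
Proof. by move=> E; apply: eq_big_seq => g; rewrite mem_gle => /E. Qed.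

Lemma ler_bsum u (F F' : G -> R) :
  (forall g, lg g <= u -> F g <= F' g) -> bsum u F <= bsum u F'.
Proof.
move=> E; rewrite /bsum big_seq [leRHS]big_seq; apply: ler_sum => g.
by rewrite mem_gle => /E.
Qed.

Lemma bsum_ge0 u (F : G -> R) : (forall g, lg g <= u -> 0 <= F g) -> 0 <= bsum u F.
Proof.
move=> E; rewrite /bsum big_seq; apply: sumr_ge0 => g.
by rewrite mem_gle => /E.
Qed.

Lemma ler_norm_bsum u (F : G -> R) : `|bsum u F| <= bsum u (fun g => `|F g|).
Proof. exact: ler_norm_sum. Qed.

Lemma bsumD (V : zmodType) u (F F' : G -> V) :
  bsum u (fun g => F g + F' g) = bsum u F + bsum u F'.
Proof. exact: big_split. Qed.

Lemma bsumN (V : zmodType) u (F : G -> V) : bsum u (fun g => - F g) = - bsum u F.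
Proof. exact: sumrN. Qed.

Lemma bsumB (V : zmodType) u (F F' : G -> V) :
  bsum u (fun g => F g - F' g) = bsum u F - bsum u F'.
Proof. by rewrite bsumD bsumN. Qed.

Lemma bsumMl (K : pzRingType) u c (F : G -> K) :
  bsum u (fun g => c * F g) = c * bsum u F.
Proof. by rewrite /bsum mulr_sumr. Qed.

Lemma bsumMr (K : pzRingType) u c (F : G -> K) :
  bsum u (fun g => F g * c) = bsum u F * c.
Proof. by rewrite /bsum mulr_suml. Qed.

Lemma bsum_neg (V : zmodType) u (F : G -> V) : u < 0 -> bsum u F = 0.
Proof. by move=> u0; rewrite /bsum gle_neg // big_seq_fset0. Qed.

Lemma bsum_fin (V : zmodType) u (F : G -> V) :
  \sum_(g \in [set g | lg g <= u]) F g = bsum u F.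
Proof. by rewrite fsbig_finite //; exact: finL. Qed.

Lemma bsum_le (V : zmodType) u v (F : G -> V) : v <= u ->
  bsum v F = \sum_(g <- gle u | lg g <= v) F g.
Proof.
move=> vu; rewrite -big_filter; apply: perm_big.
apply: uniq_perm; rewrite ?filter_uniq ?fset_uniq // => g.
rewrite mem_filter !mem_gle; case: (boolP (lg g <= v)) => //= gv.
by rewrite (le_trans gv).
Qed.

Lemma bsum_swap (V : zmodType) u (F : G -> G -> V) :
  bsum u (fun d => bsum (u - lg d) (F d)) =
  bsum u (fun n => bsum (u - lg n) (F ^~ n)).
Proof.
transitivity (\sum_(d <- gle u) \sum_(n <- gle u | lg d + lg n <= u) F d n).
  apply: eq_bigr => d _; rewrite (@bsum_le _ u) ?gerBl ?lg_ge0 //.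
  by apply: eq_bigl => n; rewrite lerBrDl.
rewrite (exchange_big_dep predT) //=; apply: eq_bigr => n _.
rewrite (@bsum_le _ u) ?gerBl ?lg_ge0 //.
by apply: eq_bigl => d; rewrite lerBrDr.
Qed.

Lemma bsum_shift (V : zmodType) u d (F : G -> V) :
  bsum (u - lg d) (fun n => F (msetD d n)) = \sum_(g <- gle u | msubset d g) F g.
Proof.
rewrite -big_filter /bsum -(big_map (msetD d) predT F); apply: perm_big.
apply: uniq_perm.
- by rewrite map_inj_uniq ?fset_uniq //; exact: can_inj (msetDKB d).
- by rewrite filter_uniq ?fset_uniq.
move=> g; rewrite mem_filter mem_gle; apply/mapP/andP.
  move=> [n]; rewrite mem_gle => nu ->; split.
    by rewrite -[X in msubset X _]msetD0 msetDS // msub0set.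
  by rewrite lgD -lerBrDl.
move=> [dg gu]; exists (msetB g d); last by rewrite msetBDKC.
by rewrite mem_gle lerBrDl -lgD msetBDKC.
Qed.

Definition divs g : {fset G} := [fset d in gle (lg g) | msubset d g]%fset.

Lemma msubset_lg d g : msubset d g -> lg d <= lg g.
Proof. by move=> dg; rewrite -(msetBDKC dg) lgD lerDl lg_ge0. Qed.

Lemma mem_divs d g : (d \in divs g) = msubset d g.
Proof.
rewrite /divs !inE mem_gle; case: (boolP (msubset d g)) => dg; rewrite ?andbF //.
by rewrite msubset_lg.
Qed.

Lemma big_divs (V : zmodType) u g (F : G -> V) : lg g <= u ->
  \sum_(d <- gle u | msubset d g) F d = \sum_(d <- divs g) F d.
Proof.
move=> gu; rewrite -big_filter; apply: perm_big.
apply: uniq_perm; rewrite ?filter_uniq ?fset_uniq // => d.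
rewrite mem_filter mem_gle mem_divs; case: (boolP (msubset d g)) => //= dg.
by rewrite (le_trans (msubset_lg dg)).
Qed.

(** The pairs (d, n) with product g correspond to the divisors d of g; this is how Dirichlet
    convolutions are summed. *)
Lemma bsum_conv (V : zmodType) u (F : G -> G -> V) :
  bsum u (fun d => bsum (u - lg d) (fun n => F d (msetD d n))) =
  bsum u (fun g => \sum_(d <- divs g) F d g).
Proof.
transitivity (\sum_(d <- gle u) \sum_(g <- gle u | msubset d g) F d g).
  by apply: eq_bigr => d _; rewrite bsum_shift.
rewrite (exchange_big_dep predT) //=; apply: eq_big_seq => g.
by rewrite mem_gle => gu; rewrite big_divs.
Qed.

(** * The Möbius function and Legendre's sieve *)

Definition mu g : R :=
  if [forall p : finsupp g, g (val p) <= 1]%N then (- 1) ^+ size g else 0.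

Lemma mu_mobius g : mobius g = (mu g)%:C%C :> R[i].
Proof.
rewrite /mobius /mu; case: ifP => _; last by rewrite rmorph0.
by rewrite rmorphXn rmorphN rmorph1.
Qed.

Lemma sqfreeP g :
  reflect (forall p, (g p <= 1)%N) [forall p : finsupp g, g (val p) <= 1]%N.
Proof.
apply: (iffP forallP) => [H p|H p]; last exact: H.
case: (boolP (p \in finsupp g)) => pg; first exact: (H [` pg]%fset).
by rewrite fsfun_dflt.
Qed.

Lemma mu0 : mu mset0 = 1.
Proof.
rewrite /mu ifT ?size_mset0 ?expr0 //; apply/sqfreeP => p.
by rewrite mset0E.
Qed.

Lemma size_msetD g h : size (msetD g h) = (size g + size h)%N.
Proof. by rewrite (perm_size (perm_msetD g h)) size_cat. Qed.

Lemma muDN p d : p \notin d -> mu (msetD [mset p] d)%mset = - mu d.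
Proof.
move=> pd; have d0 : d p = 0%N by apply/eqP; rewrite mset_eq0.
rewrite /mu size_msetD enum_msetn /= add1n exprS mulN1r.
have -> : [forall q : finsupp ([mset p] `+` d)%mset,
             ([mset p] `+` d)%mset (val q) <= 1]%N =
          [forall q : finsupp d, d (val q) <= 1]%N.
  apply/sqfreeP/sqfreeP => H q; have := H q; rewrite mset1DE.
    by apply: leq_trans; rewrite leq_addl.
  by case: eqP => [->|]; rewrite ?d0.
by case: ifP; rewrite ?oppr0.
Qed.

Lemma muD0 p d : p \in d -> mu (msetD [mset p] d)%mset = 0.
Proof.
rewrite in_mset => pd; rewrite /mu ifF //; apply/sqfreeP => H.
by have := H p; rewrite mset1DE eqxx; lia.
Qed.

Lemma norm_mu g : `|mu g| <= 1.
Proof.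
by rewrite /mu; case: ifP => _; rewrite ?normr0 // normrX normrN1 expr1n.
Qed.

(* Squarefree divisors of g come in pairs d, p+d. *)
Lemma mu_pairing p g (F : G -> R) : p \in g ->
  \sum_(d <- divs g) mu d * F d =
  \sum_(d <- divs g | p \notin (d : G)) mu d * (F d - F (msetD [mset p] d)%mset).
Proof.
move=> pg; rewrite (bigID (fun d : G => p \in d)) /= addrC.
have -> : \sum_(d <- divs g | p \in (d : G)) mu d * F d =
   \sum_(d <- divs g | (p \in (d : G)) && (p \notin (d `\ p)%mset)) mu d * F d.
  rewrite [RHS]big_mkcondr /=; apply: eq_bigr => d pd; case: ifP => // /negbFE H.
  by rewrite -(msetB1K pd) muD0 // mul0r.
have -> : \sum_(d <- divs g | (p \in (d : G)) && (p \notin (d `\ p)%mset)) mu d * F d =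
   \sum_(d <- divs g | p \notin (d : G)) mu ([mset p] `+` d)%mset * F ([mset p] `+` d)%mset.
  rewrite -big_filter -[RHS]big_filter.
  rewrite -(big_map (msetD [mset p]%mset) predT (fun d => mu d * F d)).
  apply: perm_big; apply: uniq_perm.
  - by rewrite filter_uniq ?fset_uniq.
  - rewrite map_inj_uniq ?filter_uniq ?fset_uniq //.
    exact: can_inj (msetDKB _).
  move=> d; rewrite mem_filter mem_divs; apply/idP/mapP.
    move=> /andP[/andP[pd pd'] dg]; exists (d `\ p)%mset.
      by rewrite mem_filter pd' mem_divs (msubset_trans _ dg) ?msubD1set.
    by rewrite msetB1K.
  move=> [e]; rewrite mem_filter mem_divs => /andP[pe eg] ->.
  rewrite mset1D1 msetD1K pe /=; apply/msubsetP => q; rewrite mset1DE.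
  case: eqP => [->|_]; last by rewrite add0n; exact/msubsetP.
  by move: pe pg; rewrite -mset_eq0 in_mset => /eqP ->.
rewrite -big_split /=; apply: eq_bigr => d pd.
by rewrite muDN // mulrBr mulNr.
Qed.

Lemma all_msetD (A : pred P) g h : all A (msetD g h) = all A g && all A h.
Proof. by rewrite (perm_all _ (perm_msetD g h)) all_cat. Qed.

Lemma all_mset1 (A : pred P) p : all A [mset p]%mset = A p.
Proof. by rewrite enum_msetn /= andbT. Qed.

Lemma all_mset0 (A : pred P) : all A (mset0 : G).
Proof. by rewrite enum_mset0. Qed.

Lemma all_mset1D (A : pred P) p g : all A (msetD [mset p] g)%mset = A p && all A g.
Proof. by rewrite all_msetD all_mset1. Qed.

(** If a prime p in A divides g, the divisors d and p d cancel; otherwise the unit is the only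
    divisor composed of primes in A. *)
Lemma mu_sieve (A : pred P) g :
  \sum_(d <- divs g | all A (d : G)) mu d = (all (predC A) g)%:R.
Proof.
transitivity (\sum_(d <- divs g) mu d * (all A (d : G))%:R).
  by rewrite big_mkcond; apply: eq_bigr => d _; case: ifP; rewrite ?mulr1 ?mulr0.
case: (boolP (all (predC A) g)) => [/allP gA|/allPn[p pg /negPn Ap]].
  rewrite (big_fsetD1 mset0) ?mem_divs ?msub0set //= all_mset0 mu0 mulr1.
  rewrite big_seq big1 ?addr0 // => d; rewrite !inE => /andP[d0 dg].
  case: (boolP (all A (d : G))) => [dA|]; last by rewrite mulr0.
  case: (mset_0Vmem d) => [d0'|[q qd]]; first by rewrite d0' eqxx in d0.
  move: dg; rewrite mem_gle => /andP[_ dg].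
  by have := gA q (msubset_subset dg qd); rewrite /= (allP dA).
rewrite (mu_pairing _ pg) big1 // => d _.
by rewrite all_mset1D Ap subrr mulr0.
Qed.

Lemma bsum_sieve (A : pred P) u (F : G -> R) :
  bsum u (fun d => (all A d)%:R * mu d * bsum (u - lg d) (fun n => F (msetD d n))) =
  bsum u (fun g => (all (predC A) g)%:R * F g).
Proof.
transitivity (bsum u (fun d => bsum (u - lg d) (fun n =>
    (all A d)%:R * mu d * F (msetD d n)))).
  by apply: eq_bsum => d _; rewrite bsumMl.
rewrite (bsum_conv u (fun d g => (all A d)%:R * mu d * F g)).
apply: eq_bsum => g _; rewrite -mulr_suml -mu_sieve [in RHS]big_mkcond.
by congr (_ * _); apply: eq_bigr => d _; case: ifP; rewrite ?mul1r ?mul0r.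
Qed.

Lemma all_xpred0 g : all (predC predT) g = (g == mset0).
Proof.
case: (mset_0Vmem g) => [->|[p pg]]; first by rewrite all_mset0 eqxx.
have -> : (g == mset0) = false by apply/eqP => g0; rewrite g0 in_mset0 in pg.
by apply/negP => /allP/(_ _ pg).
Qed.

(** Möbius inversion is the sieve by all primes: only the unit survives. *)
Lemma bsum_mu_inv u (F : G -> R) : 0 <= u ->
  bsum u (fun d => mu d * bsum (u - lg d) (fun n => F (msetD d n))) = F mset0.
Proof.
move=> u0; have := bsum_sieve predT u F.
under [X in X = _]eq_bsum => d _ do rewrite all_predT mul1r.
move=> ->; rewrite /bsum (big_fsetD1 mset0) ?mem_gle ?lg0 //= all_mset0 mul1r.
rewrite big_seq big1 ?addr0 // => d; rewrite !inE => /andP[d0 _].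
by rewrite all_xpred0 (negbTE d0) mul0r.
Qed.

(* The von Mangoldt function; its values are computed in [LamE]. *)
Definition Lam g : R := - \sum_(d <- divs g) mu d * lg d.

(** Pairing d with p d leaves log ||p|| times the sum of mu over the divisors prime to p, which by
    the sieve vanishes unless p is the only prime of g. *)
Lemma LamE p g : p \in g -> Lam g = lg [mset p]%mset * (all (pred1 p) g)%:R.
Proof.
move=> pg; rewrite /Lam (mu_pairing _ pg).
under eq_bigr => d _ do rewrite lgD opprD addrCA subrr addr0 mulrN mulrC.
rewrite sumrN opprK -mulr_sumr; congr (_ * _).
have -> : all (pred1 p) g = all (predC (predC1 p)) g.
  by apply: eq_all => q /=; rewrite negbK.
rewrite -mu_sieve; apply: eq_bigl => d; apply/idP/allP => [pd q qd /=|H].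
  by apply: contraNneq pd => <-.
by apply/negP => /H /=; rewrite eqxx.
Qed.

Lemma Lam_mset0 : Lam mset0 = 0.
Proof.
rewrite /Lam big_seq big1 ?oppr0 // => d; rewrite mem_divs msubset0 => /eqP ->.
by rewrite lg0 mulr0.
Qed.

Lemma Lam_ge0 g : 0 <= Lam g.
Proof.
case: (mset_0Vmem g) => [->|[p pg]]; first by rewrite Lam_mset0.
by rewrite (LamE pg) mulr_ge0 ?lg_ge0 // ler0n.
Qed.

Lemma Lam_mset1 p : Lam [mset p]%mset = lg [mset p]%mset.
Proof. by rewrite (@LamE p) ?mset11 // all_mset1 /= eqxx mulr1. Qed.

(** With an arbitrary weight F on the product, this and the next three lemmas are the convolution
    identities Lam = - (mu log) * 1, Lam = mu * log, Lam * 1 = log and Lam * mu = - mu log. *)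
Lemma bsum_Lam_mulg u (F : G -> R) :
  bsum u (fun d => Lam d * F d) =
  - bsum u (fun a => mu a * lg a * bsum (u - lg a) (fun b => F (msetD a b))).
Proof.
transitivity (- bsum u (fun g => \sum_(a <- divs g) mu a * lg a * F g)).
  by rewrite -bsumN; apply: eq_bsum => g _; rewrite /Lam mulNr mulr_suml.
rewrite -(bsum_conv u (fun a g => mu a * lg a * F g)); congr (- _).
by apply: eq_bsum => a _; rewrite bsumMl.
Qed.

Lemma bsum_Lam u (F : G -> R) :
  bsum u (fun d => Lam d * F d) =
  bsum u (fun a => mu a * bsum (u - lg a) (fun b => lg b * F (msetD a b))).
Proof.
case: (ltP u 0) => u0; first by rewrite !bsum_neg.
rewrite bsum_Lam_mulg.
(* Since log vanishes at the unit, inversion shows that (mu log) * 1 and mu * log are opposite. *)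
have := bsum_mu_inv (fun g => lg g * F g) u0; rewrite lg0 mul0r => E.
apply/eqP; rewrite -subr_eq0 -opprD oppr_eq0 -bsumD -[eqbRHS]E; apply/eqP.
apply: eq_bsum => a _; rewrite -mulrA -mulrDr -bsumMl -bsumD; congr (_ * _).
by apply: eq_bsum => b _; rewrite lgD mulrDl.
Qed.

Lemma bsum_Lam_one u (F : G -> R) :
  bsum u (fun d => Lam d * bsum (u - lg d) (fun n => F (msetD d n))) =
  bsum u (fun g => lg g * F g).
Proof.
case: (ltP u 0) => u0; first by rewrite !bsum_neg.
pose F' a := bsum (u - lg a) (fun b => lg b * F (msetD a b)).
have -> : bsum u (fun g => lg g * F g) = F' mset0.
  by rewrite /F' lg0 subr0; apply: eq_bsum => g _; rewrite mset0D.
rewrite bsum_Lam -(bsum_mu_inv F' u0); apply: eq_bsum => a _; congr (_ * _).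
rewrite /F'; under [RHS]eq_bsum => n _ do rewrite lgD opprD addrA.
rewrite [RHS]bsum_swap; apply: eq_bsum => b _.
rewrite lgD opprD addrA -bsumMl; apply: eq_bsum => n _.
by rewrite -[in RHS]msetDA [(n `+` b)%mset]msetDC msetDA.
Qed.

Lemma bsum_Lam_mu u (F : G -> R) :
  bsum u (fun d => Lam d * bsum (u - lg d) (fun n => mu n * F (msetD d n))) =
  - bsum u (fun g => mu g * lg g * F g).
Proof.
rewrite bsum_Lam_mulg; congr (- _); apply: eq_bsum => a au; congr (_ * _).
under eq_bsum => n _ do rewrite lgD opprD addrA.
rewrite bsum_swap -[in RHS](msetD0 a).
rewrite -(@bsum_mu_inv (u - lg a) (fun g => F (msetD a g))) ?subr_ge0 //.
apply: eq_bsum => n _; rewrite -bsumMl; apply: eq_bsum => b _.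
by rewrite -msetDA [(b `+` n)%mset]msetDC.
Qed.

Lemma bsumB_le (V : zmodType) u v (F : G -> V) : u <= v ->
  bsum v F - bsum u F = \sum_(g <- gle v | u < lg g) F g.
Proof.
move=> uv; rewrite (bsum_le _ uv) {1}/bsum (bigID (fun g => lg g <= u)) /=.
rewrite addrC addrK; apply: eq_bigl => g.
by rewrite ltNge.
Qed.

Lemma ler_bsumB u v (F F' : G -> R) : u <= v ->
  (forall g, u < lg g -> lg g <= v -> F g <= F' g) ->
  bsum v F - bsum u F <= bsum v F' - bsum u F'.
Proof.
move=> uv H; rewrite !bsumB_le // big_seq_cond [leRHS]big_seq_cond.
by apply: ler_sum => g /andP[]; rewrite mem_gle => gv gu; apply: H.
Qed.

Lemma bsum_mono u v (F : G -> R) : u <= v -> (forall g, 0 <= F g) ->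
  bsum u F <= bsum v F.
Proof.
by move=> uv F0; rewrite -subr_ge0 bsumB_le // sumr_ge0.
Qed.

(** The n-th unit window below u carries at most K and is discounted by exp (- t n). Windows are
    allowed to start at -1 because the lowest one may reach below 0. *)
Lemma bsum_discount (v : G -> R) (K t : R) : 0 < t -> (forall g, 0 <= v g) ->
  (forall u, -1 <= u -> bsum (u + 1) v - bsum u v <= K) ->
  forall u, bsum u (fun g => v g * expR (- t * (u - lg g))) <= K / (1 - expR (- t)).
Proof.
move=> t0 v0 vK.
have q1 : expR (- t) < 1 by rewrite expR_lt1 oppr_lt0.
have K0 : 0 <= K.
  apply: le_trans (vK 0 _); last by rewrite lerN10.
  by rewrite subr_ge0 bsum_mono // lerDl.
have B0 : 0 <= K / (1 - expR (- t)) by rewrite divr_ge0 // subr_ge0 ltW.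
suff H (n : nat) : forall u, u < n%:R ->
    bsum u (fun g => v g * expR (- t * (u - lg g))) <= K / (1 - expR (- t)).
  by move=> u; have [k uk] := exists_nat_gt u; apply: (H k).
elim: n => [|n IH] u un; first by rewrite bsum_neg.
case: (ltP u 0) => u0; first by rewrite bsum_neg.
have uu : u - 1 <= u by rewrite gerBl.
rewrite -[leLHS](subrK (bsum (u - 1) (fun g => v g * expR (- t * (u - lg g))))).
have -> : K / (1 - expR (- t)) = K + K / (1 - expR (- t)) * expR (- t).
  by field; rewrite subr_eq0 eq_sym lt_eqF.
apply: lerD.
  apply: le_trans (vK (u - 1) _); last by rewrite lerBrDr addrC subrr.
  rewrite subrK; apply: ler_bsumB => // g gu1 gu.
  rewrite ler_piMr // -expR0 ler_expR mulNr oppr_le0 mulr_ge0 ?(ltW t0) //.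
  by rewrite subr_ge0.
have -> : bsum (u - 1) (fun g => v g * expR (- t * (u - lg g))) =
    bsum (u - 1) (fun g => v g * expR (- t * (u - 1 - lg g))) * expR (- t).
  rewrite -bsumMr; apply: eq_bsum => g _; rewrite -mulrA -expRD.
  by congr (_ * expR _); ring.
rewrite ler_wpM2r ?expR_ge0 // IH //.
by rewrite ltrBlDr natr1.
Qed.

(** Where exp u < M both terms are bounded while exp (eta u) >= 1, so a larger constant absorbs this
    range. *)
Lemma log_axiomA (c C M eta : R) : 0 <= c -> 0 <= eta ->
  (forall x : R, M <= x -> `|countG nP x - c * x| <= C * x `^ eta) ->
  exists C' : R, 0 <= C' /\ forall u, 0 <= u ->
    `|bsum u (fun=> 1) - c * expR u| <= C' * expR (eta * u).
Proof.
move=> c0 eta0 HC.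
have countE u : countG nP (expR u) = bsum u (fun=> 1).
  rewrite /countG -bsum_fin; apply: eq_fsbigl.
  by apply/seteqP; split=> g /=; rewrite lg_le.
pose v := ln (Num.max 1 M).
have M1 : 0 < Num.max 1 M by rewrite lt_max ltr01.
have Ev : expR v = Num.max 1 M by rewrite lnK.
pose B := bsum v (fun=> 1 : R) + c * expR v.
have B0 : 0 <= B.
  by rewrite addr_ge0 ?mulr_ge0 ?expR_ge0 // bsum_ge0 // => g _; exact: ler01.
exists (`|C| + B); split; first by rewrite addr_ge0.
move=> u u0; have e1 : 1 <= expR (eta * u) by rewrite -expR0 ler_expR mulr_ge0.
case: (leP M (expR u)) => Mu.
  have := HC _ Mu; rewrite countE /powR gt_eqF ?expR_gt0 // expRK => /le_trans; apply.
  by rewrite ler_wpM2r ?expR_ge0 // (le_trans (ler_norm C)) // lerDl.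
have uv : u <= v by rewrite -ler_expR Ev le_max (ltW Mu) orbT.
apply: (@le_trans _ _ B).
  apply: (le_trans (ler_normB _ _)); apply: lerD.
    rewrite ger0_norm; last by apply: bsum_ge0 => g _; exact: ler01.
    by apply: bsum_mono => // g; exact: ler01.
  by rewrite ger0_norm ?mulr_ge0 ?expR_ge0 // ler_wpM2l // ler_expR.
by rewrite -[leLHS]mulr1 ler_pM // lerDr.
Qed.

(** * Mertens' and Selberg's estimates under Axiom A *)

Context (c C eta : R).
Hypotheses (c_gt0 : 0 < c) (C_ge0 : 0 <= C) (eta_lt1 : eta < 1).
Hypothesis axA : forall u, 0 <= u ->
  `|bsum u (fun=> 1) - c * expR u| <= C * expR (eta * u).

Local Notation th := (1 - eta).
Local Notation N u := (bsum u (fun=> 1)).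
Local Notation H u := (bsum u wt).
Local Notation J u := (bsum u (fun g => wt g * (u - lg g))).

Lemma th_gt0 : 0 < th. Proof. by rewrite subr_gt0. Qed.

Lemma expR_th (u : R) : expR (- u) * expR (eta * u) = expR (- th * u).
Proof. by rewrite -expRD; congr expR; ring. Qed.

Lemma axA_scaled u : 0 <= u -> `|expR (- u) * N u - c| <= C * expR (- th * u).
Proof.
move=> u0; rewrite -expR_th mulrCA; have := axA u0.
have -> : expR (- u) * N u - c = expR (- u) * (N u - c * expR u).
  by rewrite mulrBr mulrCA -expRD addNr expR0 mulr1.
by rewrite normrM ger0_norm ?expR_ge0 // ler_pM2l ?expR_gt0.
Qed.

(* [H u - exp (- u) N u] is the integral of [exp (- t) N t] up to [u], whose
   integrand is [c] up to an exponentially small error. *)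
Lemma H_asym : exists k A : R, 0 <= A /\ forall u, 0 <= u ->
  `|H u - c * u - k| <= A * expR (- th * u).
Proof.
pose D u := H u - expR (- u) * N u - c * u.
have incr u v : 0 <= u -> u <= v -> v <= u + 2^-1 ->
    `|D v - D u| <= (2 * C * expR (- th * u) + 2 * c * (v - u)) * (v - u).
  move=> u0 uv vu; pose d := v - u.
  have d0 : 0 <= d by rewrite subr_ge0.
  have d1 : d <= 2^-1 by rewrite lerBlDl.
  have [q1 q2 q3] := expRN_bounds d0 d1.
  have lo : expR (- v) * N v - expR (- v) * N u <= H v - H u.
    rewrite -!bsumMl; apply: ler_bsumB => // g gu gv.
    by rewrite mulr1 ler_expR lerN2.
  have up : H v - H u <= expR (- u) * N v - expR (- u) * N u.
    rewrite -!bsumMl; apply: ler_bsumB => // g gu gv.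
    by rewrite mulr1 ler_expR lerN2 ltW.
  have eu : expR (- v) = expR (- u) * expR (- d).
    by rewrite -expRD; congr expR; rewrite /d; ring.
  have ev : expR (- u) = expR (- v) * expR d.
    by rewrite -expRD; congr expR; rewrite /d; ring.
  have := axA_scaled u0; rewrite ler_norml => /andP[Nu _].
  have := axA_scaled (le_trans u0 uv); rewrite ler_norml => /andP[_ Nv].
  have tv : expR (- th * v) <= expR (- th * u).
    by rewrite ler_expR !mulNr lerN2 ler_pM2l // th_gt0.
  have t0 : 0 <= C * expR (- th * u) by rewrite mulr_ge0 ?expR_ge0.
  have Cv : C * expR (- th * v) <= C * expR (- th * u) by rewrite ler_wpM2l.
  set X := C * expR (- th * u) in Nu t0 Cv *.
  have Dlo : expR (- u) * N u * (1 - expR (- d)) - c * d <= D v - D u.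
    rewrite /D; move: lo; rewrite eu /d; lra.
  have Dup : D v - D u <= expR (- v) * N v * (expR d - 1) - c * d.
    rewrite /D; move: up; rewrite ev /d; lra.
  rewrite -/d -/X -[2 * C * _]mulrA -/X.
  set a := expR (- u) * N u in Nu Dlo; set b := expR (- v) * N v in Nv Dup.
  have b0 : 0 <= b by rewrite mulr_ge0 ?expR_ge0 // bsum_ge0.
  have a0 : 0 <= a by rewrite mulr_ge0 ?expR_ge0 // bsum_ge0.
  have c0 := ltW c_gt0.
  have e1 : 0 <= 1 - expR (- d) by rewrite subr_ge0 expR_le1 oppr_le0.
  rewrite ler_norml; apply/andP; split.
    apply: le_trans Dlo.
    have : (c - X) * (1 - expR (- d)) <= a * (1 - expR (- d)).
      by rewrite ler_wpM2r; lra.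
    have : c * (d - d ^+ 2) <= c * (1 - expR (- d)) by rewrite ler_wpM2l.
    have : X * (1 - expR (- d)) <= X * d by rewrite ler_wpM2l.
    have : 0 <= X * d by rewrite mulr_ge0.
    have : 0 <= c * d ^+ 2 by rewrite mulr_ge0 // sqr_ge0.
    lra.
  apply: (le_trans Dup).
  have e0 : 0 <= expR d - 1 by rewrite subr_ge0 -expR0 ler_expR.
  have : b * (expR d - 1) <= (c + X) * (expR d - 1) by rewrite ler_wpM2r; lra.
  have : (c + X) * (expR d - 1) <= (c + X) * (d + 2 * d ^+ 2) by rewrite ler_wpM2l; lra.
  have : X * (d * d) <= X * (d * 2^-1) by rewrite !ler_wpM2l.
  lra.
have C2 : 0 <= 2 * C by rewrite mulr_ge0.
have c2 : 0 <= 2 * c by rewrite mulr_ge0 // ltW.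
have h2 : 0 < 2^-1 :> R by rewrite invr_gt0.
have [k Hk] := conv_rate th_gt0 C2 c2 h2 incr.
(* [D] tends to k and leaves out exp (- u) N u, which tends to c. *)
exists (k + c), (2 * C / (1 - expR (- th)) + C); split.
  by rewrite addr_ge0 // divr_ge0 // subr_ge0 ltW // expR_lt1 oppr_lt0 th_gt0.
move=> u u0.
have -> : H u - c * u - (k + c) = (D u - k) + (expR (- u) * N u - c).
  by rewrite /D; ring.
by rewrite (le_trans (ler_normD _ _)) // mulrDl lerD ?Hk // axA_scaled.
Qed.

(** J is a primitive of H: its increment over [u, v] lies between H u (v - u) and H v (v - u). The
    asymptotics of H are thus integrated with the same rate of decay. *)
Lemma J_asym (k A : R) : 0 <= A ->
  (forall u, 0 <= u -> `|H u - c * u - k| <= A * expR (- th * u)) ->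
  exists k1 A1 : R, forall u, 0 <= u ->
    `|J u - c / 2 * u ^+ 2 - k * u - k1| <= A1 * expR (- th * u).
Proof.
move=> A0 HA; pose D u := J u - c / 2 * u ^+ 2 - k * u.
have incr u v : 0 <= u -> u <= v -> v <= u + 1 ->
    `|D v - D u| <= (A * expR (- th * u) + c * (v - u)) * (v - u).
  move=> u0 uv _; pose d := v - u.
  have d0 : 0 <= d by rewrite subr_ge0.
  pose F t g := wt g * (t - lg g).
  have Ev : J v = bsum v (fun g => wt g * (v - lg g)) by [].
  have lo : H u * d <= J v - J u.
    have -> : J v - J u = (bsum v (fun g => wt g * (v - lg g)) -
        bsum u (fun g => wt g * (v - lg g))) + H u * d.
      rewrite -[X in _ - _ + X]bsumMr -addrA; congr (_ + _).
      rewrite -[in LHS]bsumN -[in RHS]bsumN -bsumD; apply: eq_bsum => g _.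
      by rewrite /d; ring.
    rewrite lerDr bsumB_le // big_seq_cond sumr_ge0 // => g /andP[].
    by rewrite mem_gle => gv _; rewrite mulr_ge0 ?wt_ge0 // subr_ge0.
  have up : J v - J u <= H v * d.
    have -> : J v - J u = H v * d + (bsum v (fun g => wt g * (u - lg g)) -
        bsum u (fun g => wt g * (u - lg g))).
      rewrite -[X in _ = X + _]bsumMr addrA; congr (_ - _).
      rewrite -bsumD; apply: eq_bsum => g _.
      by rewrite /d; ring.
    rewrite gerDl bsumB_le // sumr_le0 // => g ug.
    by rewrite mulr_ge0_le0 ?wt_ge0 // subr_le0 ltW.
  have := HA _ u0; rewrite ler_norml => /andP[Hu _].
  have := HA _ (le_trans u0 uv); rewrite ler_norml => /andP[_ Hv].
  have tv : expR (- th * v) <= expR (- th * u).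
    by rewrite ler_expR !mulNr lerN2 ler_pM2l // th_gt0.
  have Cv : A * expR (- th * v) <= A * expR (- th * u) by rewrite ler_wpM2l.
  have t0 : 0 <= A * expR (- th * u) by rewrite mulr_ge0 ?expR_ge0.
  set X := A * expR (- th * u) in Hu t0 Cv *.
  have ud : v = u + d by rewrite /d; ring.
  have Ed : D v - D u = (J v - J u) - c * u * d - c / 2 * d ^+ 2 - k * d.
    by rewrite /D ud; field.
  have c0 : 0 <= c * d ^+ 2 by rewrite mulr_ge0 ?sqr_ge0 // ltW.
  rewrite Ed -/d ler_norml; apply/andP; split.
    have : (c * u + k - X) * d <= H u * d by rewrite ler_wpM2r; lra.
    lra.
  have : H v * d <= (c * (u + d) + k + X) * d by rewrite ler_wpM2r // -ud; lra.
  lra.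
have [k1 Hk] := conv_rate (W := D) th_gt0 A0 (ltW c_gt0) ltr01 incr.
by exists k1, (A / (1 - expR (- th))).
Qed.

Lemma N_scaled_bound u : expR (- u) * N u <= c + C.
Proof.
case: (ltP u 0) => u0; first by rewrite bsum_neg // mulr0 addr_ge0 // ltW.
have := axA_scaled u0; rewrite ler_norml => /andP[_].
have : C * expR (- th * u) <= C.
  by rewrite ler_piMr // expR_le1 mulNr oppr_le0 mulr_ge0 // (ltW th_gt0).
lra.
Qed.

Lemma H_incr u : H (u + 1) - H u <= expR 1 * (c + C).
Proof.
have -> : expR 1 * (c + C) = expR (- u) * expR (u + 1) * (c + C).
  by rewrite -expRD addKr.
apply: (@le_trans _ _ (bsum (u + 1) (fun=> expR (- u) * 1) - bsum u (fun=> expR (- u) * 1))).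
  apply: ler_bsumB; first by rewrite lerDl.
  by move=> g gu _; rewrite mulr1 ler_expR lerN2 ltW.
rewrite !bsumMl -mulrBr -mulrA ler_wpM2l ?expR_ge0 //.
rewrite -[leLHS](mulKf (lt0r_neq0 (expR_gt0 (- (u + 1))))) -expRN opprK ler_wpM2l ?expR_ge0 //.
apply: le_trans (N_scaled_bound (u + 1)).
by rewrite ler_wpM2l ?expR_ge0 // gerBl bsum_ge0.
Qed.

(** This is what an error of size exp (- t v) contributes after convolution with coefficients
    bounded by [wt]; see [bounded_sum]. *)
Lemma wt_discount (t : R) : 0 < t -> exists K : R, 0 <= K /\ forall u,
  bsum u (fun g => wt g * expR (- t * (u - lg g))) <= K.
Proof.
move=> t0; exists (expR 1 * (c + C) / (1 - expR (- t))); split.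
  apply: divr_ge0; first by rewrite mulr_ge0 ?expR_ge0 // addr_ge0 // ltW.
  by rewrite subr_ge0 expR_le1 oppr_le0 ltW.
by apply: bsum_discount => // [g|u _]; [exact: wt_ge0|exact: H_incr].
Qed.

(** * Bounds for Möbius sums *)

Definition mA (A : pred P) u := bsum u (fun g => (all A g)%:R * (mu g * wt g)).

Local Notation m u := (bsum u (fun g => mu g * wt g)).

Lemma mA_predT u : mA predT u = m u.
Proof. by apply: eq_bsum => g _; rewrite all_predT mul1r. Qed.

Lemma norm_all_mu_wt (A : pred P) g : `|(all A g)%:R * (mu g * wt g)| <= wt g.
Proof.
rewrite !normrM [ `|wt g| ]ger0_norm ?wt_ge0 // mulrA ler_piMl ?wt_ge0 //.
by rewrite mulr_ile1 // ?norm_mu //; case: (all A g); rewrite ?normr1 ?normr0.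
Qed.

Lemma wt_expR u g : wt g * expR (- (u - lg g)) = expR (- u).
Proof. by rewrite -expRD; congr expR; ring. Qed.

Lemma sieve_scaled (A : pred P) u :
  bsum u (fun d => (all A d)%:R * (mu d * wt d) *
    (expR (- (u - lg d)) * N (u - lg d))) =
  expR (- u) * bsum u (fun g => (all (predC A) g)%:R).
Proof.
have := bsum_sieve A u (fun=> 1).
under [X in _ = X -> _]eq_bsum => g _ do rewrite mulr1.
move=> <-; rewrite -bsumMl; apply: eq_bsum => d _.
by rewrite -(wt_expR u d); ring.
Qed.

Lemma bounded_sum (F : R -> R) (f : G -> R) (B t K : R) u : 0 <= B ->
  bsum u (fun g => wt g * expR (- t * (u - lg g))) <= K ->
  (forall g, `|f g| <= wt g) ->
  (forall v, 0 <= v -> `|F v| <= B * expR (- t * v)) ->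
  `|bsum u (fun g => f g * F (u - lg g))| <= B * K.
Proof.
move=> B0 HK Hf HF; apply: (le_trans (ler_norm_bsum _ _)).
apply: (@le_trans _ _ (B * bsum u (fun g => wt g * expR (- t * (u - lg g))))).
  rewrite -bsumMl; apply: ler_bsum => g gu.
  rewrite normrM mulrCA ler_pM // HF // subr_ge0 //.
by rewrite ler_wpM2l.
Qed.

(* Uniform in [A]: by the sieve, the sum with [exp (- v) N v] in place of its
   limit [c] counts the elements without prime divisor in [A]. *)
Lemma mA_bounded : exists K : R, 0 <= K /\ forall A u, `|mA A u| <= K.
Proof.
have [K [K0 HK]] := wt_discount th_gt0.
exists ((c + C + C * K) / c); split.
  by rewrite divr_ge0 ?addr_ge0 ?mulr_ge0 // ltW.
move=> A u; rewrite ler_pdivlMr // -[X in _ * X]ger0_norm ?(ltW c_gt0) // -normrM.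
case: (ltP u 0) => u0.
  by rewrite /mA bsum_neg // mul0r normr0 ?addr_ge0 ?mulr_ge0 // ltW.
have E := sieve_scaled A u.
have -> : mA A u * c = expR (- u) * bsum u (fun g => (all (predC A) g)%:R) -
   bsum u (fun d => (all A d)%:R * (mu d * wt d) * (expR (- (u - lg d)) * N (u - lg d) - c)).
  rewrite -E -bsumB /mA -bsumMr; apply: eq_bsum => g _; ring.
apply: (le_trans (ler_normB _ _)); apply: lerD.
  rewrite normrM ger0_norm ?expR_ge0 // ger0_norm; last first.
    by apply: bsum_ge0 => g _; rewrite ler0n.
  apply: le_trans (N_scaled_bound u); rewrite ler_wpM2l ?expR_ge0 //.
  by apply: ler_bsum => g _; case: (all _ g).
apply: (bounded_sum (F := fun v => expR (- v) * N v - c) (t := th)) => //.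
  by move=> g; exact: norm_all_mu_wt.
exact: axA_scaled.
Qed.

Lemma m_bounded : exists K : R, 0 <= K /\ forall u, `|m u| <= K.
Proof.
have [K [K0 HK]] := mA_bounded; exists K; split=> // u.
by rewrite -mA_predT.
Qed.

Lemma norm_mu_wt g : `|mu g * wt g| <= wt g.
Proof. by have := norm_all_mu_wt predT g; rewrite all_predT mul1r. Qed.

(** The integral of [m] over [0, u], which on the scale of x is the integral of m(t) dt/t up to
    x. *)
Definition kk u := bsum u (fun g => mu g * wt g * (u - lg g)).

(** By Möbius inversion the sum of mu(d)/||d|| H(u - lg d) is 1; inserting H v = c v + k + O(exp (-
    th v)) turns it into c kk + k m + O(1). *)
Lemma kk_bounded : exists K : R, 0 <= K /\ forall u, `|kk u| <= K.
Proof.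
have [k [A [A0 HA]]] := H_asym.
have [K [K0 HK]] := wt_discount th_gt0.
have [K' [K0' HK']] := m_bounded.
exists ((1 + `|k| * K' + A * K) / c); split.
  by rewrite divr_ge0 ?addr_ge0 ?mulr_ge0 // ltW.
move=> u; rewrite ler_pdivlMr // -[X in _ * X]ger0_norm ?(ltW c_gt0) // -normrM.
case: (ltP u 0) => u0.
  by rewrite /kk bsum_neg // mul0r normr0 ?addr_ge0 ?mulr_ge0 // ltW.
have := bsum_mu_inv wt u0; rewrite wt0 => E.
have -> : kk u * c = 1 - k * m u -
   bsum u (fun d => (mu d * wt d) * (H (u - lg d) - c * (u - lg d) - k)).
  rewrite -E -bsumMl -!bsumB /kk -bsumMr; apply: eq_bsum => g _.
  under eq_bsum => n _ do rewrite wtD.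
  rewrite bsumMl; ring.
apply: (le_trans (ler_normB _ _)); apply: lerD.
  apply: (le_trans (ler_normB _ _)); rewrite normr1 lerD2l normrM.
  by rewrite ler_wpM2l.
apply: (bounded_sum (F := fun v => H v - c * v - k) (t := th)) => //.
exact: norm_mu_wt.
Qed.

(** * From the Tatuzawa-Iseki identity to Selberg's formula *)

Lemma Tatuzawa_Iseki (F : R -> R) u : 0 <= u ->
  bsum u (fun d => mu d * wt d * (u - lg d) *
     bsum (u - lg d) (fun g => wt g * F (u - lg d - lg g))) =
  u * F u + bsum u (fun g => Lam g * wt g * F (u - lg g)).
Proof.
move=> u0; have := bsum_mu_inv (fun g => (u - lg g) * wt g * F (u - lg g)) u0.
rewrite lg0 wt0 subr0 mulr1 => <-.
under [X in _ = _ + X]eq_bsum => g _ do rewrite -mulrA.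
rewrite bsum_Lam -bsumD; apply: eq_bsum => d _.
(* The factor u - lg d - lg n from inversion and the factor lg n from Lam = mu * log add up to u -
   lg d, which is constant in the inner sum. *)
rewrite -mulrDr -bsumD -!mulrA; congr (_ * _); rewrite -!bsumMl.
by apply: eq_bsum => n _; rewrite lgD wtD opprD addrA; ring.
Qed.

Local Notation psi u := (bsum u (fun g => Lam g * wt g)).

Lemma bsum_lg_wt u : bsum u (fun g => lg g * wt g) = u * H u - J u.
Proof. by rewrite -bsumMl -bsumB; apply: eq_bsum => g _; ring. Qed.

Lemma bsum_wt_p v : bsum v (fun g => wt g * psi (v - lg g)) = v * H v - J v.
Proof.
rewrite -bsum_lg_wt -bsum_Lam_one.
transitivity (bsum v (fun g => bsum (v - lg g) (fun d => wt g * (Lam d * wt d)))).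
  by apply: eq_bsum => g _; rewrite bsumMl.
rewrite bsum_swap; apply: eq_bsum => d _; rewrite -bsumMl.
by apply: eq_bsum => g _; rewrite wtD; ring.
Qed.

(* With [F u = psi u - u - b] and [b = - k / c], the linear terms of the
   asymptotics of [H] and [J] cancel in the sum of [wt g * F (u - lg g)], which
   is therefore a constant plus an exponentially small error. *)
Lemma Mertens_Selberg : exists b K : R, 0 <= K /\ forall u, 0 <= u ->
  `|psi u - u - b| <= K /\
  `|u * (psi u - u - b) +
     bsum u (fun g => Lam g * wt g * (psi (u - lg g) - (u - lg g) - b))| <= K.
Proof.
have [k [A [A0 HA]]] := H_asym.
have [k1 [A1 HJ]] := J_asym A0 HA.
have [K2 [K20 HK2]] := m_bounded.
have [K3 [K30 HK3]] := kk_bounded.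
have [K4 [K40 HK4]] := poly_expR th_gt0.
have [K5 [K50 HK5]] := wt_discount (divr_gt0 th_gt0 (ltr0n _ 2)).
pose b := - k / c; pose F v := psi v - v - b.
(* The constant term of v H v - 2 J v - b H v: its quadratic terms cancel, and b = - k / c removes
   the linear one. *)
pose g0 := - 2 * k1 - b * k.
pose Q v := bsum v (fun g => wt g * F (v - lg g)).
pose B := A + 2 * `|A1| + `|b| * A.
have B0 : 0 <= B by rewrite !addr_ge0 ?mulr_ge0.
have QE v : 0 <= v -> `|Q v - g0| <= B * ((1 + v) * expR (- th * v)).
  move=> v0; have -> : Q v = v * H v - 2 * J v - b * H v.
    have -> : v * H v - 2 * J v - b * H v = (v * H v - J v) - J v - b * H v by ring.
    rewrite -bsum_wt_p -bsumMl -!bsumB; apply: eq_bsum => g _; rewrite /F; ring.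
  have := HA _ v0; have := HJ _ v0.
  set e0 := H v - c * v - k; set e1 := J v - _ - _ - _ => H1 H0.
  have -> : v * H v - 2 * J v - b * H v - g0 = v * e0 - 2 * e1 - b * e0.
    by rewrite /e0 /e1 /g0 /b; field; rewrite gt_eqF.
  have E0 := expR_ge0 (- th * v).
  have H1' : `|e1| <= `|A1| * expR (- th * v).
    by apply: (le_trans H1); rewrite ler_wpM2r // ler_norm.
  have N1 : `|v * e0| <= v * (A * expR (- th * v)).
    by rewrite normrM ger0_norm // ler_wpM2l.
  have N2 : `|2 * e1| <= 2 * (`|A1| * expR (- th * v)).
    by rewrite normrM ger0_norm // ler_wpM2l.
  have N3 : `|b * e0| <= `|b| * (A * expR (- th * v)).
    by rewrite normrM ler_wpM2l.
  have := ler_normB (v * e0 - 2 * e1) (b * e0).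
  have := ler_normB (v * e0) (2 * e1).
  have P1 : 0 <= v * (`|A1| * expR (- th * v)) by rewrite !mulr_ge0.
  have P2 : 0 <= v * (`|b| * A * expR (- th * v)) by rewrite !mulr_ge0.
  have P3 : 0 <= A * expR (- th * v) by rewrite !mulr_ge0.
  rewrite /B; nra.
(* The factor 1 + v covers both uses, the plain bound on F and the weight u - lg d of
   [Tatuzawa_Iseki]; [poly_expR] pays for it with half of the rate. *)
have QE2 v : 0 <= v -> `|(Q v - g0) * (1 + v)| <= B * K4 * expR (- (th / 2) * v).
  move=> v0; rewrite normrM [ `|1 + v| ]ger0_norm ?addr_ge0 // -mulrA.
  apply: (@le_trans _ _ (B * ((1 + v) ^+ 2 * expR (- th * v)))).
    by have := ler_wpM2r (addr_ge0 ler01 v0) (QE _ v0); rewrite expr2; lra.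
  by rewrite ler_wpM2l // HK4.
have QE1 v : 0 <= v -> `|Q v - g0| <= B * K4 * expR (- (th / 2) * v).
  move=> v0; apply: le_trans (QE2 _ v0); rewrite normrM ler_peMr //.
  by rewrite ger0_norm ?addr_ge0 // lerDl.
have QE3 v : 0 <= v -> `|(Q v - g0) * v| <= B * K4 * expR (- (th / 2) * v).
  move=> v0; apply: le_trans (QE2 _ v0); rewrite !normrM ler_wpM2l //.
  by rewrite !ger0_norm ?addr_ge0 // lerDr.
have BK4 : 0 <= B * K4 by rewrite mulr_ge0.
exists b, (`|g0| * (K2 + K3) + B * K4 * K5); split.
  by rewrite addr_ge0 ?mulr_ge0 // addr_ge0.
move=> u u0; split.
  have := bsum_mu_inv (fun g => wt g * F (u - lg g)) u0.
  rewrite lg0 wt0 mul1r subr0 -/(F u) => <-.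
  have -> : bsum u (fun d => mu d * bsum (u - lg d)
      (fun n => wt (d `+` n)%mset * F (u - lg (d `+` n)%mset))) =
    g0 * m u + bsum u (fun d => mu d * wt d * (Q (u - lg d) - g0)).
    rewrite -bsumMl -bsumD; apply: eq_bsum => d _; rewrite /Q.
    have -> : mu d * bsum (u - lg d) (fun n => wt (d `+` n)%mset * F (u - lg (d `+` n)%mset))
      = mu d * wt d * bsum (u - lg d) (fun g => wt g * F (u - lg d - lg g)).
      rewrite -[RHS]mulrA; congr (_ * _); rewrite -bsumMl; apply: eq_bsum => n _.
      by rewrite wtD lgD opprD addrA mulrA.
    ring.
  apply: (le_trans (ler_normD _ _)); rewrite lerD //.
    by rewrite normrM ler_wpM2l // (le_trans (HK2 u)) // lerDl.
  apply: (bounded_sum (F := fun v => Q v - g0) (t := th / 2)) => //.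
  exact: norm_mu_wt.
rewrite -/(F u) -Tatuzawa_Iseki //.
have -> : bsum u (fun d => mu d * wt d * (u - lg d) *
     bsum (u - lg d) (fun g => wt g * F (u - lg d - lg g))) =
  g0 * kk u + bsum u (fun d => mu d * wt d * ((Q (u - lg d) - g0) * (u - lg d))).
  by rewrite -bsumMl -bsumD; apply: eq_bsum => d _; rewrite /Q; ring.
apply: (le_trans (ler_normD _ _)); rewrite lerD //.
  by rewrite normrM ler_wpM2l // (le_trans (HK3 u)) // lerDr.
apply: (bounded_sum (F := fun v => (Q v - g0) * v) (t := th / 2)) => //.
exact: norm_mu_wt.
Qed.

Definition Lam2 g : R := Lam g * lg g + \sum_(d <- divs g) Lam d * Lam (msetB g d).

Lemma Lam2_ge0 g : 0 <= Lam2 g.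
Proof.
rewrite addr_ge0 ?mulr_ge0 ?Lam_ge0 ?lg_ge0 // sumr_ge0 // => d _.
by rewrite mulr_ge0 ?Lam_ge0.
Qed.

Lemma bsum_Lam2 u (F : G -> R) :
  bsum u (fun g => Lam2 g * F g) = bsum u (fun g => Lam g * lg g * F g) +
  bsum u (fun d => Lam d * bsum (u - lg d) (fun n => Lam n * F (msetD d n))).
Proof.
have -> : bsum u (fun d => Lam d * bsum (u - lg d) (fun n => Lam n * F (msetD d n))) =
  bsum u (fun g => \sum_(d <- divs g) Lam d * Lam (msetB g d) * F g).
  rewrite -(bsum_conv u (fun d g => Lam d * Lam (msetB g d) * F g)).
  apply: eq_bsum => d _; rewrite -bsumMl; apply: eq_bsum => n _.
  by rewrite msetDKB mulrA.
rewrite -bsumD; apply: eq_bsum => g _.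
by rewrite /Lam2 mulrDl mulr_suml.
Qed.

Local Notation H2 u := (bsum u (fun g => Lam2 g * wt g)).

(** The sum of Lam log / ||g|| is u psi u minus the sum of Lam wt (u - lg), and the latter cancels
    against the same sum in the convolution term. What remains of [H2] beyond u^2 + 2 b u is bounded
    by [Mertens_Selberg]; the constant here is twice the one there. *)
Lemma Selberg : exists b K : R, 0 <= K /\ (forall u, 0 <= u ->
  `|psi u - u| <= K) /\ (forall u, 0 <= u -> `|H2 u - u ^+ 2 - b * u| <= K).
Proof.
have [b [K [K0 HK]]] := Mertens_Selberg.
exists (2 * b), (K + `|b| + `|b| * K + b ^+ 2).
have b2 := sqr_ge0 b; have bK : 0 <= `|b| * K by rewrite mulr_ge0.
split; first by rewrite !addr_ge0.
split => u u0.
  have [H1 _] := HK u u0; have -> : psi u - u = (psi u - u - b) + b by ring.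
  by apply: (le_trans (ler_normD _ _)); lra.
have [H1 T] := HK u u0; rewrite bsum_Lam2.
set F := psi u - u - b in H1 T; set T' := u * F + _ in T.
have -> : bsum u (fun g => Lam g * lg g * wt g) +
   bsum u (fun d => Lam d * bsum (u - lg d) (fun n => Lam n * wt (d `+` n)%mset)) -
   u ^+ 2 - 2 * b * u = T' + b * F + b ^+ 2.
  have -> : bsum u (fun g => Lam g * lg g * wt g) = u * psi u -
      bsum u (fun g => Lam g * wt g * (u - lg g)).
    by rewrite -bsumMl -bsumB; apply: eq_bsum => g _; ring.
  have -> : bsum u (fun d => Lam d * bsum (u - lg d) (fun n => Lam n * wt (d `+` n)%mset))
      = (T' - u * F) + bsum u (fun g => Lam g * wt g * (u - lg g)) + b * psi u.
    rewrite [T' - _]addrC /T' addKr -bsumMl -!bsumD; apply: eq_bsum => d _.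
    under eq_bsum => n _ do rewrite wtD mulrCA.
    rewrite bsumMl; ring.
  by rewrite /F; ring.
apply: (le_trans (ler_normD _ _)); rewrite [ `|b ^+ 2| ]ger0_norm //.
rewrite lerD2r; apply: (le_trans (ler_normD _ _)).
have : `|b * F| <= `|b| * K by rewrite normrM ler_wpM2l.
have := normr_ge0 b; lra.
Qed.

(* The identity [u m(u) + sum Lam wt m(u - lg) = kk u] used twice. *)
Lemma m_log_sq : exists K : R, 0 <= K /\ forall u, 0 <= u ->
  `|m u| * u ^+ 2 <=
    bsum u (fun g => Lam2 g * wt g * `|m (u - lg g)|) + K * (1 + u).
Proof.
have [K3 [K30 HK3]] := kk_bounded.
have [b [K [K0 [Hp _]]]] := Selberg.
have mL v : m v * v + bsum v (fun g => Lam g * wt g * m (v - lg g)) = kk v.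
  have := bsum_Lam_mu v wt => E.
  have -> : bsum v (fun g => Lam g * wt g * m (v - lg g)) =
      bsum v (fun d => Lam d * bsum (v - lg d) (fun n => mu n * wt (d `+` n)%mset)).
    apply: eq_bsum => d _; rewrite -mulrA -bsumMl; congr (_ * _).
    by apply: eq_bsum => n _; rewrite wtD; ring.
  by rewrite E -bsumMr -bsumB; apply: eq_bsum => g _; ring.
exists (2 * K3 + K3 * K); split; first by rewrite addr_ge0 ?mulr_ge0.
move=> u u0; rewrite -[X in _ * X](ger0_norm (sqr_ge0 u)) -normrM.
under [X in _ <= X + _]eq_bsum => g _ do rewrite -mulrA.
rewrite bsum_Lam2.
have E : m u * u ^+ 2 = u * kk u - bsum u (fun g => Lam g * wt g * kk (u - lg g)) -
    bsum u (fun g => Lam g * lg g * (wt g * m (u - lg g))) +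
    bsum u (fun d => Lam d * bsum (u - lg d) (fun n => Lam n * (wt (d `+` n)%mset * m (u - lg (d `+` n)%mset)))).
  have -> : m u * u ^+ 2 = u * kk u - bsum u (fun g => Lam g * wt g * m (u - lg g)) * u.
    by rewrite -mL; ring.
  have -> : bsum u (fun d => Lam d * bsum (u - lg d) (fun n => Lam n * (wt (d `+` n)%mset * m (u - lg (d `+` n)%mset))))
    = bsum u (fun d => Lam d * wt d * bsum (u - lg d) (fun n => Lam n * wt n * m (u - lg d - lg n))).
    apply: eq_bsum => d _; rewrite -[RHS]mulrA; congr (_ * _); rewrite -bsumMl.
    by apply: eq_bsum => n _; rewrite wtD lgD opprD addrA; ring.
  rewrite -addrA -addrA; congr (_ + _); rewrite -bsumMr -!bsumN -!bsumD.
  by apply: eq_bsum => d _; rewrite -(mL (u - lg d)); ring.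
rewrite E.
have n1 : `|u * kk u| <= K3 * u by rewrite normrM ger0_norm // mulrC ler_wpM2r.
have n2 : `|bsum u (fun g => Lam g * wt g * kk (u - lg g))| <= K3 * (u + K).
  apply: (le_trans (ler_norm_bsum _ _)); apply: (@le_trans _ _ (K3 * psi u)).
    rewrite -bsumMl; apply: ler_bsum => g _; rewrite normrM mulrC.
    by rewrite [ `|Lam g * _| ]ger0_norm ?mulr_ge0 ?Lam_ge0 ?wt_ge0 // ler_wpM2r // mulr_ge0 ?Lam_ge0 ?wt_ge0.
  by rewrite ler_wpM2l //; have := Hp _ u0; rewrite ler_norml; lra.
have n3 : `|bsum u (fun g => Lam g * lg g * (wt g * m (u - lg g)))| <=
   bsum u (fun g => Lam g * lg g * (wt g * `|m (u - lg g)|)).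
  apply: (le_trans (ler_norm_bsum _ _)); apply: ler_bsum => g _.
  by rewrite !normrM (ger0_norm (Lam_ge0 g)) (ger0_norm (lg_ge0 g)) (ger0_norm (wt_ge0 g)).
have n4 : `|bsum u (fun d => Lam d * bsum (u - lg d) (fun n => Lam n * (wt (d `+` n)%mset * m (u - lg (d `+` n)%mset))))|
  <= bsum u (fun d => Lam d * bsum (u - lg d) (fun n => Lam n * (wt (d `+` n)%mset * `|m (u - lg (d `+` n)%mset)|))).
  apply: (le_trans (ler_norm_bsum _ _)); apply: ler_bsum => d _.
  rewrite normrM (ger0_norm (Lam_ge0 d)) ler_wpM2l ?Lam_ge0 //.
  apply: (le_trans (ler_norm_bsum _ _)); apply: ler_bsum => n _.
  by rewrite !normrM (ger0_norm (Lam_ge0 n)) (ger0_norm (wt_ge0 _)).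
set a1 := u * kk u in n1 *; set a2 := bsum u _ in n2 *.
set a3 := bsum u _ in n3 *; set a4 := bsum u _ in n4 *.
have := ler_normD (a1 - a2 - a3) a4; have := ler_normB (a1 - a2) a3.
have := ler_normB a1 a2.
have : 0 <= K3 * K * u by rewrite !mulr_ge0.
lra.
Qed.

(** * Decay of [m] *)

Lemma H_modulus : exists A : R, 0 <= A /\ forall u v, 0 <= u -> u <= v ->
  H v - H u <= c * (v - u) + A * expR (- th * u).
Proof.
have [k [A [A0 HA]]] := H_asym.
exists (2 * A); split; first by rewrite mulr_ge0.
move=> u v u0 uv; have := HA _ u0; have := HA _ (le_trans u0 uv).
rewrite !ler_norml => /andP[_ h1] /andP[h2 _].
have tv : A * expR (- th * v) <= A * expR (- th * u).
  by rewrite ler_wpM2l // ler_expR !mulNr lerN2 ler_pM2l // th_gt0.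
lra.
Qed.

(** With [H_modulus], far out m moves by at most c (v - u) up to an exponentially small term, so its
    jumps do no harm. *)
Lemma m_modulus u v : u <= v -> `|m v - m u| <= H v - H u.
Proof.
move=> uv; rewrite !bsumB_le //; apply: (le_trans (ler_norm_sum _ _ _)).
by apply: ler_sum => g _; exact: norm_mu_wt.
Qed.

Lemma kk_modulus u v : u <= v ->
  `|kk v - kk u - m u * (v - u)| <= (H v - H u) * (v - u).
Proof.
move=> uv; have -> : kk v - kk u - m u * (v - u) =
   bsum v (fun g => mu g * wt g * (v - lg g)) - bsum u (fun g => mu g * wt g * (v - lg g)).
  rewrite /kk -bsumMr -addrA -opprD -bsumD; congr (_ - _); apply: eq_bsum => g _.
  ring.
rewrite !bsumB_le // mulr_suml; apply: (le_trans (ler_norm_sum _ _ _)).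
rewrite big_seq_cond [leRHS]big_seq_cond; apply: ler_sum => g /andP[].
rewrite mem_gle => gv ug; rewrite normrM ler_pM ?normr_ge0 ?norm_mu_wt //.
by rewrite ger0_norm ?subr_ge0 // lerB // ltW.
Qed.

(* If [m] kept one sign and stayed away from 0 on a long interval, [kk] would be
   unbounded, since [kk] is a primitive of [m]. *)
Lemma m_small_values (e : R) : 0 < e -> exists L u0 : R, [/\ 0 < L, 0 <= u0 &
  forall u, u0 <= u -> exists t, [/\ u <= t, t <= u + L & `|m t| <= e]].
Proof.
move=> e0; have [A [A0 HA]] := H_modulus.
have [K3 [K30 HK3]] := kk_bounded.
have e8 : 0 < e / 8 by rewrite divr_gt0.
have [u0 [u00 Hu0]] := expR_small A0 th_gt0 e8.
(* Beyond [u0] a step of length d changes m by at most e / 8 + e / 8 = e / 4. *)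
pose d := e / (8 * c).
have d0 : 0 < d by rewrite divr_gt0 ?mulr_gt0.
have cd : c * d = e / 8 by rewrite /d; field; rewrite gt_eqF.
(* As long as |m| > e, each step moves kk by at least (e - e / 4) d in one direction; J such steps
   exceed 2 K3, whereas |kk| <= K3. *)
have [J HJ] := exists_nat_gt (2 * K3 / (3 / 4 * e * d)).
have ed : 0 < 3 / 4 * e * d by have := mulr_gt0 e0 d0; lra.
have J0 : 0 < J%:R :> R by apply: le_lt_trans HJ; rewrite divr_ge0 ?(ltW ed) // mulr_ge0.
exists (J%:R * d), u0; split=> //; first by rewrite mulr_gt0.
move=> u uu0; apply/not_existsP => Hno.
have big (j : nat) : (j <= J)%N -> e < `|m (u + j%:R * d)|.
  move=> jJ; rewrite ltNge; apply/negP => Hj; apply: (Hno (u + j%:R * d)); split=> //.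
    by rewrite lerDl mulr_ge0 // ltW.
  by rewrite lerD2l ler_pM2r // ler_nat.
have st (j : nat) : H (u + j.+1%:R * d) - H (u + j%:R * d) <= e / 4.
  have j0 : 0 <= j%:R * d by rewrite mulr_ge0 // ltW.
  have := HA (u + j%:R * d) (u + j.+1%:R * d).
  have -> : u + j.+1%:R * d - (u + j%:R * d) = d by rewrite -natr1; ring.
  rewrite cd => H1; have := Hu0 (u + j%:R * d).
  have a1 : u0 <= u + j%:R * d by rewrite (le_trans uu0) // lerDl.
  move=> /(_ a1) H2; have := H1 (le_trans u00 a1).
  have a2 : u + j%:R * d <= u + j.+1%:R * d by rewrite lerD2l ler_pM2r // ler_nat.
  move=> /(_ a2); lra.
have mono (j : nat) : u + j%:R * d <= u + j.+1%:R * d by rewrite lerD2l ler_pM2r // ler_nat.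
(* s is the sign of m u; steps of size e / 4 cannot cross the gap between - e and e. *)
have claim (s : R) : `|s| = 1 -> e < s * m u -> False.
  move=> s1 sm.
  have pos (j : nat) : (j <= J)%N -> e < s * m (u + j%:R * d).
    elim: j => [|j IH] jJ; first by rewrite mul0r addr0.
    have := IH (ltnW jJ); have := big _ jJ; have := m_modulus (mono j); have := st j.
    have : `|s * (m (u + j.+1%:R * d) - m (u + j%:R * d))| =
      `|m (u + j.+1%:R * d) - m (u + j%:R * d)| by rewrite normrM s1 mul1r.
    have : `|s * m (u + j.+1%:R * d)| = `|m (u + j.+1%:R * d)| by rewrite normrM s1 mul1r.
    move=> <- <-; rewrite mulrBr; set x := s * m _; set y := s * m _.
    move=> h1 h2 h3 h4; have := le_trans h2 h1; rewrite ler_norml => /andP[h5 _].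
    by rewrite -(ger0_norm (_ : 0 <= x)) //; lra.
  have inc (j : nat) : (j <= J)%N ->
      j%:R * (3 / 4 * e * d) <= s * (kk (u + j%:R * d) - kk u).
    elim: j => [|j IH] jJ; first by rewrite !mul0r addr0 subrr mulr0.
    have p1 := pos j (ltnW jJ); have := kk_modulus (mono j); have := st j.
    have -> : u + j.+1%:R * d - (u + j%:R * d) = d by rewrite -natr1; ring.
    move=> h1; set X := kk _ - kk _ - _ => h2.
    have : `|s * X| <= e / 4 * d.
      by rewrite normrM s1 mul1r (le_trans h2) // ler_wpM2r // ltW.
    rewrite ler_norml => /andP[h3 _].
    have -> : s * (kk (u + j.+1%:R * d) - kk u) = s * X +
      (s * m (u + j%:R * d)) * d + s * (kk (u + j%:R * d) - kk u) by rewrite /X; ring.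
    have := IH (ltnW jJ); rewrite -natr1.
    have : e * d <= s * m (u + j%:R * d) * d by rewrite ler_pM2r // ltW.
    lra.
  have := inc J (leqnn _); move: HJ; rewrite ltr_pdivrMr // => h1 h2.
  have : `|s * (kk (u + J%:R * d) - kk u)| <= 2 * K3.
    rewrite normrM s1 mul1r; apply: (le_trans (ler_normB _ _)).
    by have := HK3 u; have := HK3 (u + J%:R * d); lra.
  rewrite ler_norml; lra.
have := big 0%N (leq0n _); rewrite mul0r addr0.
case: (ger0P (m u)) => _ mu_; first by apply: (claim 1); rewrite ?normr1 ?mul1r.
by apply: (claim (-1)); rewrite ?normrN1 ?mulN1r.
Qed.

(** A point where |m| <= al / 8 opens a window of length h = al / (8 c): m moves there by at most al
    / 8 + al / 8, hence stays below al / 2, as [Selberg_descent] requires. *)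
Lemma m_improve (al : R) : 0 < al -> exists ka : R, 0 < ka /\
  forall al' : R, al <= al' ->
    (exists u1 : R, forall u, u1 <= u -> `|m u| <= al') ->
    exists u2 : R, forall u, u2 <= u -> `|m u| <= al' - ka.
Proof.
move=> al0; have e0 : 0 < al / 8 by rewrite divr_gt0.
have [L [u0 [L0 u00 HL]]] := m_small_values e0.
have [A [A0 HA]] := H_modulus.
have [v0 [v00 Hv0]] := expR_small A0 th_gt0 e0.
have [b [K [K0 [_ HS]]]] := Selberg.
have [K2 [K20 HK2]] := m_bounded.
have [K7 [K70 HK7]] := m_log_sq.
pose h := al / (8 * c).
have h0 : 0 < h by rewrite divr_gt0 ?mulr_gt0.
have ch : c * h = al / 8 by rewrite /h; field; rewrite gt_eqF.
have L2w g : 0 <= Lam2 g * wt g by rewrite mulr_ge0 ?Lam2_ge0 ?wt_ge0.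
pose X u v := bsum v (fun g => Lam2 g * wt g * `|m (u - lg g)|).
apply: (@Selberg_descent R (fun u => `|m u|) (fun u => H2 u) X b K K2 K7 L h
  (Num.max u0 v0)) => //.
- by rewrite le_max u00.
- by move=> u; exact: bsum_ge0.
- by move=> u v uv; exact: bsum_mono.
- move=> u y; rewrite -bsumMl; apply: ler_bsum => g _.
  by rewrite mulrC ler_wpM2r // HK2.
- move=> u x y a xy Hm; rewrite mulrBr -!bsumMl; apply: ler_bsumB => // g g1 g2.
  rewrite mulrC ler_wpM2r // Hm //; first by rewrite lerD2l lerN2.
  by rewrite ltrD2l ltrN2.
move=> u; rewrite ge_max => /andP[uu0 uv0].
have [t [t1 t2 t3]] := HL _ uu0; exists t; split=> // t' tt tth.
have := m_modulus tt; have := HA _ _ (le_trans v00 (le_trans uv0 t1)) tt.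
have := Hv0 _ (le_trans uv0 t1) => b1 b2 b3.
have cc : c * (t' - t) <= c * h by rewrite ler_pM2l // lerBlDl.
have := ler_normD (m t' - m t) (m t); rewrite subrK => b4.
apply: (le_trans b4); move: b2 b3; set x1 := H t' - H t; set x2 := `|m t' - m t|.
set x3 := `|m t| in t3 *; set x4 := A * _ in b1 *; move=> b2 b3.
clearbody x1 x2 x3 x4; clear -al0 b1 b2 b3 cc ch t3; lra.
Qed.

(* Equivalent to the prime number theorem for the semigroup. *)
Lemma m_to0 (e : R) : 0 < e -> exists u0 : R, forall u, u0 <= u -> `|m u| <= e.
Proof.
pose X := [set a : R | exists u0 : R, forall u, u0 <= u -> `|m u| <= a].
have lbX : lbound X 0 by move=> a [u0 /(_ u0 (lexx _))]; exact: le_trans.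
have infX : has_inf X.
  split; last by exists 0.
  by have [K2 [_ HK2]] := m_bounded; exists K2, 0 => u _.
have i0 : inf X <= 0.
  rewrite leNgt; apply/negP => ipos.
  (* Since [ka] is fixed before the bound it improves, a bound within [ka] of the infimum can be
     improved to one below the infimum. *)
  have [ka [ka0 Hka]] := m_improve ipos.
  have [a Xa alt] := inf_adherent ka0 infX.
  have ia : inf X <= a by apply: ge_inf => //; exists 0.
  have [u2 Hu2] := Hka _ ia Xa.
  have : inf X <= a - ka by apply: ge_inf; [exists 0|exists u2].
  lra.
move=> e0; have [a [u0 Hu0] ae] := inf_adherent e0 infX.
exists u0 => u /Hu0 /le_trans; apply; lra.
Qed.

(** * Deleting primes one at a time *)

Local Notation lp q := (lg [mset q]%mset).
Local Notation wp q := (wt [mset q]%mset).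

Lemma to0_contraction (B A0 : R -> R) q (K : R) : 0 <= K ->
  (forall u, `|B u| <= K) -> (forall u, B u = A0 u + wp q * B (u - lp q)) ->
  to0 A0 -> to0 B.
Proof.
move=> K0 BK Hrec HA e e0.
have [|u0 Hu0] := @limsup_contraction R (fun u => `|B u|) 0 (lp q) (lp q) K
  (lg1_gt0 _) K0 (lexx _) BK _ e e0; last first.
  by exists u0 => u /Hu0; rewrite mul0r add0r.
move=> e1 /HA[u0 Hu0]; exists u0 => u /Hu0 h.
rewrite add0r (Hrec u) (le_trans (ler_normD _ _)) // lerD // normrM.
by rewrite ger0_norm ?wt_ge0.
Qed.

Lemma bsum_split_at (V : zmodType) q u (F : G -> V) :
  bsum u F = \sum_(g <- gle u | q \notin (g : G)) F g +
             bsum (u - lp q) (fun g => F (msetD [mset q]%mset g)).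
Proof.
rewrite bsum_shift /bsum (bigID (fun g : G => q \notin g)) /=; congr (_ + _).
by apply: eq_bigl => g; rewrite negbK msub1set.
Qed.

Lemma all_predD1 (A : pred P) q g : all (predD1 A q) g = (q \notin g) && all A g.
Proof.
apply/allP/andP => [H|[qg /allP H] p pg /=].
  split; first by apply/negP => /H /=; rewrite eqxx.
  by apply/allP => p /H /= /andP[].
by rewrite H // andbT; apply: contraNneq qg => <-.
Qed.

(** Removing q from A divides the Dirichlet series of mu on A by the Euler factor 1 - ||q||^-s.
    [cntA_predD1] and [HA_predD1] are the same step for the count and for the sum of 1/||g||. *)
Lemma mA_predD1 (A : pred P) q u : A q ->
  mA (predD1 A q) u = mA A u + wp q * mA (predD1 A q) (u - lp q).
Proof.
move=> Aq; rewrite [in X in _ = X + _]/mA (bsum_split_at q).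
have -> : bsum (u - lp q) (fun g => (all A (msetD [mset q] g)%mset)%:R *
    (mu (msetD [mset q] g)%mset * wt (msetD [mset q] g)%mset)) =
    - (wp q * mA (predD1 A q) (u - lp q)).
  rewrite -bsumMl -bsumN; apply: eq_bsum => g _.
  rewrite all_mset1D Aq all_predD1 wtD.
  by case: (boolP (q \in (g : G))) => qg; [rewrite muD0 // |rewrite muDN //]; rewrite /=; ring.
rewrite subrK /mA /bsum [RHS]big_mkcond; apply: eq_bigr => g _.
by rewrite all_predD1; case: (q \notin (g : G)); rewrite ?mul0r.
Qed.

Definition cntA (A : pred P) u : R := bsum u (fun g => (all A g)%:R).

Definition HA (A : pred P) u : R := bsum u (fun g => (all A g)%:R * wt g).

Lemma cntA_predD1 (A : pred P) q u : A q ->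
  cntA A u = cntA (predD1 A q) u + cntA A (u - lp q).
Proof.
move=> Aq; rewrite [LHS](bsum_split_at q); congr (_ + _).
  rewrite /cntA /bsum [LHS]big_mkcond; apply: eq_bigr => g _.
  by rewrite all_predD1; case: (q \notin (g : G)).
by apply: eq_bsum => g _; rewrite all_mset1D Aq.
Qed.

Lemma HA_predD1 (A : pred P) q u : A q ->
  HA A u = HA (predD1 A q) u + wp q * HA A (u - lp q).
Proof.
move=> Aq; rewrite [LHS](bsum_split_at q); congr (_ + _).
  rewrite /HA /bsum [LHS]big_mkcond; apply: eq_bigr => g _.
  by rewrite all_predD1; case: (q \notin (g : G)); rewrite ?mul0r.
rewrite -bsumMl; apply: eq_bsum => g _; rewrite all_mset1D Aq wtD; ring.
Qed.

Lemma eq_mA (A A' : pred P) : A =1 A' -> mA A =1 mA A'.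
Proof. by move=> E u; apply: eq_bsum => g _; rewrite (eq_all E). Qed.

Lemma eq_cntA (A A' : pred P) : A =1 A' -> cntA A =1 cntA A'.
Proof. by move=> E u; apply: eq_bsum => g _; rewrite (eq_all E). Qed.

Lemma eq_HA (A A' : pred P) : A =1 A' -> HA A =1 HA A'.
Proof. by move=> E u; apply: eq_bsum => g _; rewrite (eq_all E). Qed.

(** Starting from [m_to0], each excluded prime preserves the limit 0 by [to0_contraction], whose
    ratio wp q is less than 1. *)
Lemma mA_cofinite (s : seq P) : to0 (mA [pred p | p \notin s]).
Proof.
have [K [K0 HK]] := mA_bounded.
elim: s => [|q s IH].
  by move=> e /m_to0[u0 Hu0]; exists u0 => u /Hu0; rewrite -mA_predT.
case: (boolP (q \in s)) => qs.
  apply: to0_ext IH => u _; apply: eq_mA => p /=; rewrite inE negb_or.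
  by case: eqP => // ->; rewrite qs.
have E : predD1 [pred p | p \notin s] q =1 [pred p | p \notin q :: s].
  by move=> p /=; rewrite inE negb_or.
apply: (@to0_contraction _ (mA [pred p | p \notin s]) q K K0) => // u.
by rewrite -!(eq_mA E) (@mA_predD1 _ q).
Qed.

Lemma cntA_bound (A : pred P) u : 0 <= expR (- u) * cntA A u <= c + C.
Proof.
have c0 : 0 <= cntA A u by apply: bsum_ge0 => g _; rewrite ler0n.
rewrite mulr_ge0 ?expR_ge0 //=; apply: le_trans (N_scaled_bound u).
rewrite ler_wpM2l ?expR_ge0 //; apply: ler_bsum => g _.
by case: (all _ g).
Qed.

(** The same contraction, started from the empty set of primes, where only the unit is counted. *)
Lemma cntA_finite (s : seq P) : to0 (fun u => expR (- u) * cntA [pred p | p \in s] u).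
Proof.
elim: s => [|q s IH].
  move=> e e0; have [u0 [u00 Hu0]] := expR_small ler01 (@ltr01 R) e0.
  exists u0 => u uu; have := Hu0 _ uu; rewrite mul1r mulN1r.
  have -> : cntA [pred p | p \in [::]] u = 1.
    rewrite /cntA /bsum (big_fsetD1 mset0) ?mem_gle ?lg0 ?(le_trans u00) //=.
    rewrite all_mset0 big_seq big1 ?addr0 // => g; rewrite !inE => /andP[g0 _].
    have -> : all [pred p | p \in [::]] (g : G) = all (predC predT) (g : G).
      by apply: eq_all => p /=.
    by rewrite all_xpred0 (negbTE g0).
  by rewrite mulr1 ger0_norm ?expR_ge0.
case: (boolP (q \in s)) => qs.
  apply: to0_ext IH => u _; congr (_ * _); apply: eq_cntA => p /=; rewrite inE.
  by case: eqP => // ->; rewrite qs.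
have E : predD1 [pred p | p \in q :: s] q =1 [pred p | p \in s].
  by move=> p /=; rewrite inE; case: eqP => // ->; rewrite (negbTE qs).
have cC : 0 <= c + C by rewrite addr_ge0 // ltW.
apply: (@to0_contraction _ (fun u => expR (- u) * cntA [pred p | p \in s] u) q _ cC) => //.
  by move=> u; have /andP[h1 h2] := cntA_bound [pred p | p \in q :: s] u; rewrite ger0_norm.
move=> u; rewrite -(eq_cntA E) [in LHS](@cntA_predD1 _ q) /= ?inE ?eqxx //.
rewrite mulrDr; congr (_ + _).
by rewrite mulrA wt_expR.
Qed.

(** Each prime of s multiplies the density seen by unit windows by 1 - wp q; with no prime excluded
    this density is c. *)
Lemma HA_incr (s : seq P) : uniq s ->
  to0 (fun u => HA [pred p | p \notin s] (u + 1) - HA [pred p | p \notin s] u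
     - c * \prod_(q <- s) (1 - wp q)).
Proof.
elim: s => [_|q s IH /= /andP[qs us]].
  move=> e e0; have [k [A [A0 HHA]]] := H_asym.
  have e2 : 0 < e / 2 by rewrite divr_gt0.
  have [u0 [u00 Hu0]] := expR_small A0 th_gt0 e2.
  exists u0 => u uu; rewrite big_nil mulr1.
  have E v : HA [pred p | p \notin [::]] v = H v.
    by apply: eq_bsum => g _; rewrite (eq_all (a2 := predT)) // all_predT mul1r.
  have uv : 0 <= u by apply: le_trans uu.
  have h1 := HHA _ uv; have h2 := HHA _ (addr_ge0 uv ler01).
  have h3 := Hu0 _ uu; have h4 := Hu0 (u + 1) (le_trans uu _).
  rewrite !E; have -> : H (u + 1) - H u - c =
    (H (u + 1) - c * (u + 1) - k) - (H u - c * u - k) by ring.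
  apply: (le_trans (ler_normB _ _)).
  have h5 : A * expR (- th * (u + 1)) <= e / 2 by apply: h4; rewrite lerDl.
  by rewrite (le_trans (lerD h2 h1)) // (le_trans (lerD h5 h3)) // -splitr.
have E : predD1 [pred p | p \notin s] q =1 [pred p | p \notin q :: s].
  by move=> p /=; rewrite inE negb_or.
have {}IH := IH us.
move=> e e0; have e2 : 0 < e / 2 by rewrite divr_gt0.
have [u0 Hu0] := IH _ e2; exists (Num.max u0 (u0 + lp q)) => u.
rewrite ge_max => /andP[/Hu0 h1]; rewrite -lerBrDr => /Hu0 h2.
rewrite big_cons.
have -> : HA [pred p | p \notin q :: s] (u + 1) - HA [pred p | p \notin q :: s] u -
  c * ((1 - wp q) * \prod_(j <- s) (1 - wp j)) =
  (HA [pred p | p \notin s] (u + 1) - HA [pred p | p \notin s] u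
     - c * \prod_(q <- s) (1 - wp q)) - wp q *
  (HA [pred p | p \notin s] (u - lp q + 1) - HA [pred p | p \notin s] (u - lp q)
     - c * \prod_(q <- s) (1 - wp q)).
  have F v : HA [pred p | p \notin q :: s] v =
      HA [pred p | p \notin s] v - wp q * HA [pred p | p \notin s] (v - lp q).
    by rewrite (@HA_predD1 [pred p | p \notin s] q v) // (eq_HA E) addrK.
  by rewrite !F [u + 1 - _]addrAC; ring.
apply: (le_trans (ler_normB _ _)); rewrite normrM (ger0_norm (wt_ge0 _)).
rewrite [e]splitr lerD // (le_trans _ h2) // ler_piMl // /wt expR_le1 oppr_le0.
exact: lg_ge0.
Qed.

Lemma wp_lt1 q : wp q < 1.
Proof. by rewrite /wt expR_lt1 oppr_lt0 lg1_gt0. Qed.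

(** Without the cut at u, [HA] for the set s is the Euler product of the 1 / (1 - wp q), and there
    would be equality. *)
Lemma prod_HA (s : seq P) u : uniq s ->
  \prod_(q <- s) (1 - wp q) * HA [pred p | p \in s] u <= 1.
Proof.
have HA0 A v : 0 <= HA A v.
  by apply: bsum_ge0 => g _; rewrite mulr_ge0 ?ler0n ?wt_ge0.
elim: s => [_|q s IH /= /andP[qs us]].
  rewrite big_nil mul1r; case: (ltP u 0) => u0; first by rewrite /HA bsum_neg.
  rewrite /HA /bsum (big_fsetD1 mset0) ?mem_gle ?lg0 //=.
  rewrite all_mset0 big_seq big1 ?addr0 ?wt0 ?mulr1 // => g; rewrite !inE => /andP[g0 _].
  have -> : all [pred p | p \in [::]] (g : G) = all (predC predT) (g : G).
    by apply: eq_all => p /=.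
  by rewrite all_xpred0 (negbTE g0) mul0r.
have E : predD1 [pred p | p \in q :: s] q =1 [pred p | p \in s].
  by move=> p /=; rewrite inE; case: eqP => // ->; rewrite (negbTE qs).
rewrite big_cons; apply: le_trans (IH us); rewrite mulrAC mulrC ler_wpM2l //.
  by apply: prodr_ge0 => p _; rewrite subr_ge0 ltW // wp_lt1.
have := @HA_predD1 [pred p | p \in q :: s] q u.
rewrite /= inE eqxx => /(_ isT); rewrite (eq_HA E) => E2.
rewrite mulrBl mul1r lerBlDr {1}E2 lerD2l ler_wpM2l ?wt_ge0 //.
apply: bsum_mono; first by rewrite gerBl lg_ge0.
by move=> g; rewrite mulr_ge0 ?ler0n ?wt_ge0.
Qed.

(** * Sums and products over primes *)

Lemma finP u : finite_set [set q : P | lp q <= u].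
Proof.
suff: finite_set ((fun q : P => [mset q]%mset : G) @^-1` [set g | lg g <= u]) by [].
apply: finite_preimage.
  by move=> p q _ _; apply: msetn_inj.
exact: finL.
Qed.

Definition ple u : {fset P} := fset_set [set q | lp q <= u].

Lemma mem_ple u q : (q \in ple u) = (lp q <= u).
Proof.
rewrite in_fset_set; last exact: finP.
by apply/idP/idP => [/set_mem|/mem_set].
Qed.

Lemma lg_mem q g : q \in g -> lp q <= lg g.
Proof. by move=> qg; apply: msubset_lg; rewrite msub1set. Qed.

Lemma Mertens_primes : exists K : R, 0 <= K /\ forall u, 0 <= u ->
  \sum_(q <- ple u) lp q * wp q <= u + K.
Proof.
have [b [K [K0 [Hp _]]]] := Selberg.
exists K; split=> // u u0; have := Hp _ u0; rewrite ler_norml => /andP[_ h].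
suff : \sum_(q <- ple u) lp q * wp q <= psi u by lra.
have -> : \sum_(q <- ple u) lp q * wp q =
    \sum_(g <- [seq ([mset q]%mset : G) | q <- ple u]) Lam g * wt g.
  by rewrite big_map; apply: eq_bigr => q _; rewrite Lam_mset1.
apply: ler_sum_sub.
- by rewrite map_inj_uniq ?fset_uniq // => x y; apply: msetn_inj.
- exact: fset_uniq.
- by move=> g /mapP[q]; rewrite mem_ple mem_gle => ? ->.
- by move=> g; rewrite mulr_ge0 ?Lam_ge0 ?wt_ge0.
Qed.

Definition Psum u := \sum_(q <- ple u) wp q.

(** Halving u replaces partial summation: the primes with u / 2 < lp q <= u contribute at most (2 /
    u) (u + K) <= 2 + 2 K, and about log u / log 2 halvings reach the bounded range. *)
Lemma Psum_bound : exists K1 K2 : R, [/\ 0 <= K1, 0 <= K2 & forall u, 1 <= u ->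
  Psum u <= K1 + K2 * ln u].
Proof.
have [K [K0 HK]] := Mertens_primes.
have P0 u : 0 <= Psum u by apply: sumr_ge0 => q _; exact: wt_ge0.
have ln2 : 0 < ln 2 :> R by rewrite ln_gt0 // ltr1n.
have mono u v : u <= v -> Psum u <= Psum v.
  move=> uv; apply: ler_sum_sub; [exact: fset_uniq|exact: fset_uniq| |].
    by move=> q; rewrite !mem_ple => /le_trans; apply.
  by move=> q; exact: wt_ge0.
have half u : 1 <= u -> Psum u <= Psum (u / 2) + (2 + 2 * K).
  move=> u1; rewrite /Psum (bigID (fun q => lp q <= u / 2)) /=; apply: lerD.
    rewrite -big_filter; apply: ler_sum_sub; rewrite ?filter_uniq ?fset_uniq //.
      by move=> q; rewrite mem_filter !mem_ple => /andP[].
    by move=> q; exact: wt_ge0.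
  have u0 : 0 < u by rewrite (lt_le_trans ltr01).
  apply: (@le_trans _ _ (2 / u * (u + K))); last first.
    rewrite -mulrA mulrDr mulVf ?gt_eqF // mulrDr mulr1 lerD2l ler_pM2l //.
    by rewrite mulrC ler_pdivrMr // ler_peMr.
  have := HK _ (ltW u0) => /(ler_wpM2l (_ : 0 <= 2 / u)) h.
  apply: le_trans (h _); last by rewrite divr_ge0 // ltW.
  rewrite mulr_sumr [leRHS](bigID (fun q => lp q <= u / 2)) /=.
  rewrite -[leLHS]add0r; apply: lerD.
    apply: sumr_ge0 => q _; rewrite mulr_ge0 ?mulr_ge0 ?wt_ge0 ?lg_ge0 //.
    by rewrite invr_ge0 ltW.
  apply: ler_sum => q; rewrite -ltNge => /ltW hq.
  rewrite mulrA ler_peMl ?wt_ge0 // -ler_pdivrMl ?mulr1; last by rewrite divr_gt0.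
  by rewrite invf_div.
exists (Psum 2), ((2 + 2 * K) / ln 2); split=> //.
  by apply: divr_ge0; [lra|exact: ltW].
have K2 : 0 <= (2 + 2 * K) / ln 2 by apply: divr_ge0; [lra|exact: ltW].
move=> u u1; have [n un] := exists_nat_gt u.
have {un} : u <= 2 ^+ n.
  rewrite (le_trans (ltW un)) //; elim: (n) => [|k]; first by rewrite expr0.
  rewrite exprS -natr1; have : 1 <= 2 ^+ k :> R by rewrite exprn_ege1 // ler1n.
  lra.
elim: n u u1 => [|n IH] u u1 un.
  have -> : u = 1 by apply/eqP; rewrite eq_le u1 -(expr0 2) un.
  by rewrite ln1 mulr0 addr0 mono // ler1n.
case: (leP u 2) => u2.
  by rewrite (le_trans (mono _ _ u2)) // lerDl mulr_ge0 // ln_ge0.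
apply: (le_trans (half _ u1)).
have h1 : 1 <= u / 2 by rewrite ler_pdivlMr // mul1r ltW.
have h2 : u / 2 <= 2 ^+ n by rewrite ler_pdivrMr // mulrC -exprS.
have := IH _ h1 h2; rewrite lnM ?posrE ?invr_gt0 //; last lra.
rewrite lnV ?posrE // mulrBr divfK ?gt_eqF //; lra.
Qed.

Definition copT T : pred P := [pred q | q \notin ple T].

(** An element with lg g <= T has all its primes in [ple T], so [prod_HA] bounds the product by 1 /
    H T, and H T grows like c T. *)
Lemma prod_ple_small (e : R) : 0 < e ->
  exists T : R, 0 <= T /\ \prod_(q <- ple T) (1 - wp q) <= e.
Proof.
move=> e0; have [k [A [A0 HHA]]] := H_asym.
pose T := Num.max 0 ((e^-1 + A - k) / c).
have T0 : 0 <= T by rewrite le_max lexx.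
exists T; split=> //.
have := HHA _ T0; rewrite ler_norml => /andP[h1 _].
have : A * expR (- th * T) <= A.
  by rewrite ler_piMr // expR_le1 mulNr oppr_le0 mulr_ge0 // ltW // th_gt0.
have : e^-1 + A - k <= c * T.
  by rewrite mulrC -ler_pdivrMr // le_max lexx orbT.
move=> h2 h3; have h4 : e^-1 <= H T by lra.
have := prod_HA T (fset_uniq (ple T)).
have -> : HA [pred p | p \in enum_fset (ple T)] T = H T.
  apply: eq_bsum => g gT; rewrite (_ : all _ g = true) ?mul1r //.
  by apply/allP => q /lg_mem qg /=; rewrite mem_ple (le_trans qg).
set pr := \prod_(q <- _) _ => h5.
have pr0 : 0 <= pr by apply: prodr_ge0 => p _; rewrite subr_ge0 ltW // wp_lt1.
have : pr * e^-1 <= 1 by apply: le_trans h5; rewrite ler_wpM2l.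
by rewrite ler_pdivrMr // mul1r.
Qed.

(* The contribution to the error of the elements all of whose primes exceed [T]. *)
Definition discT T u :=
  bsum u (fun g => (all (copT T) g)%:R * wt g * expR (- th * (u - lg g))).

(** Going from u - 1 to u multiplies the old terms by exp (- th) and adds a unit window whose mass
    tends to a, c times the product over [ple T]. The limsup is at most a / (1 - exp (- th)), and T
    makes this at most e / 2. *)
Lemma discT_small (e : R) : 0 < e -> exists T u0 : R, 0 <= T /\ forall u, u0 <= u ->
  discT T u <= e.
Proof.
move=> e0; have q1 : 0 < 1 - expR (- th) by rewrite subr_gt0 expR_lt1 oppr_lt0 th_gt0.
have e1 : 0 < e / 2 * (1 - expR (- th)) / c.
  by rewrite divr_gt0 // mulr_gt0 // divr_gt0.
have [T [T0 HT]] := prod_ple_small e1; exists T.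
have [K [K0 HK]] := wt_discount th_gt0.
pose a := c * \prod_(q <- ple T) (1 - wp q).
have a0 : 0 <= a.
  rewrite mulr_ge0 ?(ltW c_gt0) //.
  by apply: prodr_ge0 => p _; rewrite subr_ge0 ltW // wp_lt1.
have ae : a / (1 - expR (- th)) <= e / 2.
  by rewrite ler_pdivrMr // /a mulrC -ler_pdivlMr.
have [|||u0 Hu0] := @limsup_contraction R (discT T) a th 1 K th_gt0 K0 a0 _ _ (e / 2) _.
- move=> u; apply: le_trans (HK u); apply: ler_bsum => g _.
  rewrite -mulrA; apply: ler_piMl; last by case: (all _ g).
  by apply: mulr_ge0; [exact: wt_ge0|exact: expR_ge0].
- move=> e' e'0; have [u0 Hu0] := HA_incr (fset_uniq (ple T)) e'0.
  exists (u0 + 1) => u; rewrite -lerBrDr => /Hu0; rewrite subrK ler_norml => /andP[_ h].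
  have uu : u - 1 <= u by rewrite gerBl.
  rewrite -[leLHS](subrK (bsum (u - 1) (fun g => (all (copT T) g)%:R * wt g * expR (- th * (u - lg g))))).
  apply: lerD.
    apply: (@le_trans _ _ (HA (copT T) u - HA (copT T) (u - 1))).
      apply: ler_bsumB => // g gu1 gu.
      rewrite ler_piMr ?mulr_ge0 ?ler0n ?wt_ge0 // expR_le1 mulNr oppr_le0.
      by rewrite mulr_ge0 ?subr_ge0 // ltW // th_gt0.
    by move: h; rewrite -/(copT T) -/a; lra.
  rewrite /discT -bsumMl; apply: ler_bsum => g _.
  by rewrite mulrCA -expRD; apply: ler_wpM2l; [rewrite mulr_ge0 ?ler0n ?wt_ge0|rewrite ler_expR; lra].
- by rewrite divr_gt0.
exists u0; split=> // u /Hu0; lra.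
Qed.

(** * Error terms attached to a prime *)

Lemma lp_le p q : (lp p <= lp q) = (nP p <= nP q).
Proof. by rewrite lg_le expR_lg !normG1. Qed.

Definition above q : pred P := [pred p | nP q < nP p].

(** Powers of q are allowed, other primes of the same norm are not: this is the uniqueness demanded
    of distinguishable elements. *)
Definition aboveq q : pred P := [pred p | (p == q) || (nP q < nP p)].

(* [q] is the only prime divisor of [g] of least norm; by [DsetP] the elements
   of D(G, S) other than the unit are those with [uniq_min q g] for some q in S. *)
Definition uniq_min q g : bool := (q \in g) && all (aboveq q) g.

(** Other primes with the norm of q are allowed here, so several q may qualify; [QS] counts those in
    S. *)
Definition is_max q g : bool := (q \in g) && all (predC (above q)) g.

Lemma mA_above q : to0 (mA (above q)).
Proof.
have := mA_cofinite (ple (lp q)); apply: to0_ext => u _; apply: eq_mA => p /=.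
by rewrite mem_ple lp_le -ltNge.
Qed.

Lemma mA_aboveq q : to0 (mA (aboveq q)).
Proof.
have := mA_cofinite [seq p <- ple (lp q) | p != q]; apply: to0_ext => u _; apply: eq_mA => p /=.
by rewrite mem_filter mem_ple lp_le negb_and negbK -ltNge.
Qed.

Lemma all_above_notin q g : all (above q) g -> q \notin g.
Proof. by move=> /allP H; apply/negP => /H; rewrite /above /= ltxx. Qed.

Lemma all_aboveq_notin q g : q \notin g -> all (aboveq q) g = all (above q) g.
Proof.
move=> qg; apply: eq_in_all => p pg; rewrite /aboveq /above /=.
by case: eqP => // E; rewrite -E pg in qg.
Qed.

Lemma uniq_min1D q g : q \notin g -> uniq_min q (msetD [mset q] g)%mset = all (above q) g.
Proof.
by move=> qg; rewrite /uniq_min mset1D1 all_mset1D all_aboveq_notin // /aboveq /= eqxx.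
Qed.

(** A squarefree d with unique least prime q is q times a product of primes of larger norm, and mu
    changes sign. *)
Lemma bsum_uniq_min q u (F : R -> R) :
  bsum u (fun d => (uniq_min q d)%:R * (mu d * wt d) * F (u - lg d)) =
  - wp q * bsum (u - lp q) (fun g => (all (above q) g)%:R * (mu g * wt g) * F (u - lp q - lg g)).
Proof.
rewrite (bsum_split_at q) big1 ?add0r => [|d qd]; last first.
  by rewrite /uniq_min (negbTE qd) !mul0r.
rewrite -bsumMl; apply: eq_bsum => g _; rewrite lgD opprD addrA wtD.
case: (boolP (q \in g)) => qg.
  rewrite muD0 // (_ : all (above q) g = false).
    by rewrite mulr0n; ring.
  by apply/negP => /all_above_notin; rewrite qg.
rewrite uniq_min1D // muDN //; ring.
Qed.

Lemma bsum_is_max q u : bsum u (fun g => (is_max q g)%:R) = cntA (predC (above q)) (u - lp q).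
Proof.
rewrite (bsum_split_at q) big1 ?add0r => [|d qd]; last by rewrite /is_max (negbTE qd).
by apply: eq_bsum => g _; rewrite /is_max mset1D1 all_mset1D /above /= ltxx.
Qed.

Definition ebar t := expR (- t) * N t - c.

(** exp (- u) times the error made in the sum of b_q(d) N(x/||d||) when N(y) is replaced by c y. *)
Definition xq q u := bsum u (fun d => (uniq_min q d)%:R * (mu d * wt d) * ebar (u - lg d)).

Definition yq q u := bsum u (fun d => (uniq_min q d)%:R * (mu d * wt d)).

(** By the sieve, the part with N becomes the proportion of elements composed of the finitely many
    primes of norm at most ||q||; the part with c is a multiple of [mA (above q)]. *)
Lemma xq_to0 q : to0 (xq q).
Proof.
pose Y t := bsum t (fun g => (all (above q) g)%:R * (mu g * wt g) * ebar (t - lg g)).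
suff YT : to0 Y.
  apply: (@to0_ext R (fun u => - wp q * Y (u - lp q))).
    by move=> u _; rewrite /xq bsum_uniq_min.
  exact/to0Z/to0_shift.
apply: (@to0_ext R (fun t => expR (- t) * cntA (predC (above q)) t + (- c) * mA (above q) t)).
  move=> t _; rewrite /cntA -sieve_scaled -bsumMl -bsumD; apply: eq_bsum => g _.
  rewrite /ebar; ring.
apply: to0D; last exact/to0Z/mA_above.
have := cntA_finite (ple (lp q)); apply: to0_ext => u _; congr (_ * _).
by apply: eq_cntA => p /=; rewrite mem_ple lp_le -leNgt.
Qed.

(* Summing [mu] over the divisors [d] of [g] with [uniq_min q d] gives [-1] if [q]
   is a prime divisor of [g] of maximal norm, and 0 otherwise: Alladi's duality. *)
Lemma xq_yq q u : xq q u = - (expR (- u) * bsum u (fun g => (is_max q g)%:R)) - c * yq q u.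
Proof.
rewrite /xq; under eq_bsum => d _ do rewrite /ebar mulrBr.
rewrite bsumB; congr (_ - _); last by rewrite /yq bsumMr mulrC.
rewrite (@bsum_uniq_min q u (fun t => expR (- t) * N t)) sieve_scaled bsum_is_max /cntA.
have -> : expR (- u) = wp q * expR (- (u - lp q)) by rewrite wt_expR.
ring.
Qed.

Lemma uniq_min_inj p q g : uniq_min p g -> uniq_min q g -> p = q.
Proof.
move=> /andP[pg /allP Hp] /andP[qg /allP Hq].
have /orP[/eqP->//|h1] := Hp _ qg; have /orP[/eqP->//|h2] := Hq _ pg.
by have := lt_trans h1 h2; rewrite ltxx.
Qed.

Lemma sum_uniq_min_le (s : seq P) (A : pred P) g : uniq s ->
  \sum_(q <- s | A q) (uniq_min q g)%:R <= (has (fun q => A q && uniq_min q g) s)%:R :> R.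
Proof.
move=> us; elim: s us => [|q s IH /= /andP[qs us]]; first by rewrite big_nil.
rewrite big_cons; case: ifP => Aq //=; last exact: IH.
case: (boolP (uniq_min q g)) => Uqg /=; last by rewrite add0r IH.
rewrite big_seq_cond big1 ?addr0 // => p /andP[ps _].
case: (boolP (uniq_min p g)) => // Up; rewrite (uniq_min_inj Up Uqg) in ps.
by rewrite ps in qs.
Qed.

(** Primes up to T are treated one by one and the others in bulk: a given d belongs to at most one
    q, and if q is beyond T so are all primes of d. Those q together contribute at most C times
    [discT T]. *)
Lemma sum_xq_to0 : to0 (fun u => \sum_(q <- ple u) `|xq q u|).
Proof.
have Cp : 0 < C + 1 by rewrite ltr_wpDl.
move=> e e0; have e2 : 0 < e / 2 by rewrite divr_gt0.
have e3 : 0 < e / 2 / (C + 1) by rewrite divr_gt0.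
have [T [u0 [T0 Hu0]]] := discT_small e3.
have [u1 Hu1] := @to0_sum R P (ple T) (fun q u => `|xq q u|)
  (fun q => to0_norm (xq_to0 q)) _ e2.
exists (Num.max T (Num.max u0 u1)) => u.
rewrite !ge_max => /and3P[Tu /Hu0 h0 /Hu1 h1].
rewrite ger0_norm ?sumr_ge0 // (bigID (fun q => q \in ple T)) /=.
rewrite [e]splitr; apply: lerD.
  apply: le_trans h1; rewrite ger0_norm ?sumr_ge0 // -big_filter.
  apply: ler_sum_sub; rewrite ?filter_uniq ?fset_uniq // => q.
  by rewrite mem_filter => /andP[].
have h2 : C * discT T u <= e / 2.
  move: h0; rewrite ler_pdivlMr //.
  have : 0 <= discT T u.
    apply: bsum_ge0 => g _; apply: mulr_ge0; last exact: expR_ge0.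
    by apply: mulr_ge0; [exact: ler0n|exact: wt_ge0].
  lra.
apply: le_trans h2; rewrite -bsumMl.
apply: (@le_trans _ _ (\sum_(q <- ple u | q \notin ple T)
   bsum u (fun d => (uniq_min q d)%:R * (wt d * (C * expR (- th * (u - lg d))))))).
  apply: ler_sum => q _; apply: (le_trans (ler_norm_bsum _ _)).
  apply: ler_bsum => d du; rewrite -mulrA normrM ger0_norm ?ler0n // ler_wpM2l ?ler0n //.
  by rewrite normrM ler_pM ?norm_mu_wt // axA_scaled // subr_ge0.
rewrite /bsum exchange_big /=; apply: ler_bsum => d du.
have -> : C * ((all (copT T) d)%:R * wt d * expR (- th * (u - lg d))) =
  (all (copT T) d)%:R * (wt d * (C * expR (- th * (u - lg d)))) by ring.
rewrite -mulr_suml; apply: ler_wpM2r.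
  by rewrite mulr_ge0 ?wt_ge0 // mulr_ge0 ?expR_ge0.
apply: (le_trans (sum_uniq_min_le _ _ (fset_uniq _))).
case: hasP => [[q _ /andP[qT /andP[qd /allP dq]]]|_]; last by rewrite ler0n.
rewrite (_ : all _ d = true) //; apply/allP => p pd /=.
apply: contra qT; rewrite !mem_ple; apply: le_trans; rewrite lp_le.
by have /orP[/eqP ->|/ltW] := dq _ pd.
Qed.

(** * The sums I_r, split according to the least prime q *)

Definition iqr q (r : G) u := bsum u (fun h => mu h * wt h * (uniq_min q (msetD h r))%:R).

Lemma uniq_minD q h r : uniq_min q (msetD h r) =
  ((q \in h) || (q \in r)) && (all (aboveq q) h && all (aboveq q) r).
Proof. by rewrite /uniq_min in_msetD all_msetD. Qed.

Lemma iqr_in q (r : G) u : q \in r -> iqr q r u = (all (aboveq q) r)%:R * mA (aboveq q) u.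
Proof.
move=> qr; rewrite -bsumMl; apply: eq_bsum => h _; rewrite uniq_minD qr orbT /=.
by case: (all _ h); case: (all _ r); rewrite ?mulr0 ?mulr1 ?mul0r ?mul1r.
Qed.

Lemma iqr_notin q (r : G) u : q \notin r ->
  iqr q r u = (all (aboveq q) r)%:R * (- wp q * mA (above q) (u - lp q)).
Proof.
move=> qr.
have -> : - wp q * mA (above q) (u - lp q) =
    bsum u (fun d => (uniq_min q d)%:R * (mu d * wt d) * 1).
  rewrite (@bsum_uniq_min q u (fun=> 1)); congr (_ * _); apply: eq_bsum => g _.
  by rewrite mulr1.
rewrite -bsumMl; apply: eq_bsum => h _; rewrite uniq_minD (negbTE qr) orbF /uniq_min.
by case: (q \in h); case: (all _ h); case: (all _ r);
  rewrite ?mulr0 ?mulr1 ?mul0r ?mul1r ?mulr0.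
Qed.

Lemma iqr_to0 q r : to0 (iqr q r).
Proof.
case: (boolP (q \in r)) => qr.
  apply: (@to0_ext R (fun u => (all (aboveq q) r)%:R * mA (aboveq q) u)).
    by move=> u _; rewrite iqr_in.
  exact/to0Z/mA_aboveq.
apply: (@to0_ext R (fun u => (all (aboveq q) r)%:R * (- wp q * mA (above q) (u - lp q)))).
  by move=> u _; rewrite iqr_notin.
by apply: to0Z; apply: to0Z; apply: to0_shift; exact: mA_above.
Qed.

(** If q divides r, the sum vanishes unless q is the unique least prime of r, which happens for one
    q at most; otherwise q must come from h, at the cost of a factor wp q. Summed over ||q|| <=
    ||r|| this is O(1 + log log ||r||). *)
Lemma iqr_bound : exists K : R, 0 <= K /\ forall q r u,
  `|iqr q r u| <= K * ((uniq_min q r)%:R + wp q).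
Proof.
have [K [K0 HK]] := mA_bounded; exists K; split=> // q r u.
case: (boolP (q \in r)) => qr.
  rewrite iqr_in // /uniq_min qr /= normrM mulrDr normr_nat mulrC.
  rewrite (le_trans (ler_wpM2r (ler0n _ _) (HK _ _))) // lerDl.
  by rewrite mulr_ge0 ?wt_ge0.
rewrite iqr_notin // /uniq_min (negbTE qr) /= add0r normrM normrM normrN.
rewrite (ger0_norm (wt_ge0 _)) [K * _]mulrC.
apply: (@le_trans _ _ (wp q * `|mA (above q) (u - lp q)|)).
  rewrite ler_piMl ?mulr_ge0 ?wt_ge0 //.
  by case: (all _ r); rewrite ?normr1 ?normr0.
by rewrite ler_wpM2l ?wt_ge0.
Qed.

(** Every prime of h has norm at least ||q||. In I_r with r <> e this confines the sum over q to lp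
    q <= lg r. *)
Lemma uniq_min_lp_le q g h : h != mset0 -> msubset h g -> uniq_min q g -> lp q <= lg h.
Proof.
case: (mset_0Vmem h) => [->|[p ph] _ hg /andP[_ /allP H]]; first by rewrite eqxx.
apply: le_trans (lg_mem ph); rewrite lp_le.
by have /orP[/eqP ->|/ltW] := H _ (msubset_subset hg ph).
Qed.

(** Up to [u1] there are finitely many r, each giving a shifted function that tends to 0; beyond
    [u1] the majorant [bd] is uniform in u. *)
Lemma Tannery (al : G -> R) (J : G -> R -> R) (bd : G -> R) :
  (forall r, 0 <= al r) -> (forall r, to0 (J r)) -> (forall r u, `|J r u| <= bd r) ->
  (forall e : R, 0 < e -> exists u1 : R, forall u, u1 <= u ->
     bsum u (fun r => al r * bd r) - bsum u1 (fun r => al r * bd r) <= e) ->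
  to0 (fun u => bsum u (fun r => al r * `|J r (u - lg r)|)).
Proof.
move=> al0 J0 Jb Hal e e0; have e2 : 0 < e / 2 by rewrite divr_gt0.
have [u1 Hu1] := Hal _ e2.
have [u2 Hu2] := @to0_sum R G (gle u1) (fun r u => al r * `|J r (u - lg r)|)
  (fun r => to0Z (al r) (to0_norm (@to0_shift R (lg r) _ (J0 r)))) _ e2.
exists (Num.max u1 u2) => u; rewrite ge_max => /andP[h1 /Hu2 h2].
rewrite ger0_norm; last by apply: bsum_ge0 => r _; rewrite mulr_ge0.
rewrite -[leLHS](subrK (bsum u1 (fun r => al r * `|J r (u - lg r)|))).
rewrite [e]splitr; apply: lerD; last exact: le_trans (ler_norm _) h2.
apply: le_trans (Hu1 _ h1); apply: ler_bsumB => // r _ _.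
by rewrite ler_wpM2l.
Qed.

Definition Jr r u := \sum_(q <- ple (lg r)) `|iqr q r u|.

Lemma Jr_to0 r : to0 (Jr r).
Proof. by apply: to0_sum => q; apply: to0_norm; exact: iqr_to0. Qed.

Lemma Jr_bound : exists K : R, 0 <= K /\ forall r u,
  `|Jr r u| <= K * (1 + Psum (lg r)).
Proof.
have [K [K0 HK]] := iqr_bound; exists K; split=> // r u.
rewrite ger0_norm ?sumr_ge0 // /Jr.
apply: (@le_trans _ _ (\sum_(q <- ple (lg r)) K * ((uniq_min q r)%:R + wp q))).
  by apply: ler_sum => q _.
rewrite -mulr_sumr big_split ler_wpM2l // lerD2r.
apply: (le_trans (sum_uniq_min_le predT r (fset_uniq _))).
by case: has.
Qed.

Lemma sum_Jr_to0 (al : G -> R) :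
  (forall r, 0 <= al r) ->
  (forall e : R, 0 < e -> exists u0 : R, 1 < u0 /\ forall u, u0 <= u ->
     bsum u (fun r => al r * ln (lg r)) - bsum u0 (fun r => al r * ln (lg r)) <= e) ->
  to0 (fun u => bsum u (fun r => al r * `|Jr r (u - lg r)|)).
Proof.
move=> al0 Hal.
have [K [K0 HK]] := Jr_bound; have [K1 [K2 [K10 K20 HP]]] := Psum_bound.
apply: (@Tannery al Jr (fun r => K * (1 + Psum (lg r)))) => // [r|e e0]; first exact: Jr_to0.
have [u0 [u01 Hu0]] := Hal 1 ltr01.
pose L := ln u0; have L0 : 0 < L by rewrite ln_gt0.
(* Chosen so that K (1 + K1 + K2 ln v) <= M ln v for v >= u0; u0 > 1 makes L positive. *)
pose M := K * ((1 + K1) / L + K2).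
have M0 : 0 <= M.
  by rewrite mulr_ge0 // addr_ge0 // divr_ge0 ?addr_ge0 // ltW.
have e1 : 0 < e / (M + 1) by rewrite divr_gt0 // ltr_wpDl.
have [u1 [u11 Hu1]] := Hal _ e1.
pose v := Num.max u0 u1.
have [v0 v1] : u0 <= v /\ u1 <= v by rewrite /v !le_max !lexx ?orbT.
exists v => u vu.
apply: (@le_trans _ _ (M * (bsum u (fun r => al r * ln (lg r)) - bsum v (fun r => al r * ln (lg r))))).
  rewrite mulrBr -!bsumMl; apply: ler_bsumB => // r vr ru.
  rewrite [leRHS]mulrCA ler_wpM2l // /M -mulrA ler_wpM2l //.
  have r0 : u0 < lg r by rewrite (le_lt_trans v0).
  have lr : L <= ln (lg r).
    by rewrite ler_ln ?posrE ?(ltW r0) //; [rewrite (lt_trans ltr01)|rewrite (lt_trans _ r0) // (lt_trans ltr01)].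
  have := HP (lg r); rewrite (le_trans (ltW u01) (ltW r0)) => /(_ isT) h.
  have : 1 + K1 <= (1 + K1) / L * ln (lg r).
    by rewrite mulrAC ler_pdivlMr // ler_wpM2l // addr_ge0.
  lra.
have h1 : bsum u (fun r => al r * ln (lg r)) - bsum v (fun r => al r * ln (lg r)) <= e / (M + 1).
  apply: le_trans (Hu1 _ (le_trans v1 vu)); rewrite lerD2l lerN2.
  rewrite -subr_ge0 bsumB_le // sumr_ge0 // => r u1r.
  by rewrite mulr_ge0 // ln_ge0 // ltW // (lt_trans u11).
apply: (le_trans (ler_wpM2l M0 h1)).
rewrite mulrA ler_pdivrMr ?ltr_wpDl // mulrC ler_pM2l // lerDl.
exact: ler01.
Qed.

(** * Duality between least and greatest prime divisors *)

Lemma pdvdGE (q : P) (g : G) : pdvdG q g <-> q \in g.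
Proof.
split=> [[r ->]|qg]; first by rewrite /Gmul mset1D1.
by exists (msetB g [mset q]%mset); rewrite /Gmul msetBDKC // msub1set.
Qed.

Lemma nP_le_Nplus q g : q \in g -> nP q <= Nplus nP g.
Proof. by move=> qg; exact: le_bigmax_seq. Qed.

Lemma Nplus_le q g : (forall p, p \in g -> nP p <= nP q) -> Nplus nP g <= nP q.
Proof.
move=> Hq; rewrite /Nplus big_seq; apply: bigmax_le; last exact: Hq.
exact/ltW/nP_gt1.
Qed.

Lemma Nminus_le q g : q \in g -> Nminus nP g <= nP q.
Proof. by move=> qg; exact: ge_bigmin_seq. Qed.

Lemma is_max_Nplus q g : is_max q g <-> q \in g /\ nP q = Nplus nP g.
Proof.
split=> [/andP[qg /allP H]|[qg E]].
  split=> //; apply/eqP; rewrite eq_le nP_le_Nplus //=.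
  by apply: Nplus_le => p /H; rewrite /= -leNgt.
apply/andP; split=> //; apply/allP => p pg; rewrite /= -leNgt E.
exact: nP_le_Nplus.
Qed.

Lemma uniq_min_Nminus q g : uniq_min q g -> nP q = Nminus nP g.
Proof.
move=> /andP[qg /allP H]; apply/eqP; rewrite eq_le Nminus_le // andbT.
rewrite /Nminus big_seq; apply: le_bigmin; first exact: nP_le_Nplus.
by move=> p /H /orP[/eqP ->|/ltW].
Qed.

Lemma DsetP (S : set P) g : (Dset nP S g /\ g <> Gunit) <-> (exists q, S q /\ uniq_min q g).
Proof.
split=> [[[->//|[[g0 [p0 [_ up]]] [q [/pdvdGE qg qN Sq]]]] _]|[q [Sq U]]].
  exists q; split=> //; apply/andP; split=> //; apply/allP => p pg.
  have E : p0 = q by apply: up; split=> //; apply/pdvdGE.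
  rewrite /aboveq /=; case: eqP => //= pq.
  rewrite lt_neqAle {2}qN Nminus_le // andbT; apply/eqP => pN; apply: pq.
  by rewrite -E; apply/esym/up; split; [exact/pdvdGE|rewrite -pN].
have g0 : g <> Gunit by move=> E; move: U; rewrite E /uniq_min in_mset0.
split=> //; right; have qN := uniq_min_Nminus U; move: U => /andP[qg /allP H].
split; last by exists q; split=> //; exact/pdvdGE.
split=> //; exists q; split=> [|p [/pdvdGE pg pN]]; first by split=> //; exact/pdvdGE.
have /orP[/eqP ->//|] := H _ pg.
by rewrite pN qN ltxx.
Qed.

Lemma fsum_le (V : zmodType) u (Q : set G) (F : G -> V) :
  \sum_(g \in [set g | normG nP g <= expR u /\ Q g]) F g =
  bsum u (fun g => if g \in Q then F g else 0).
Proof.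
rewrite -bsum_fin -fsbig_mkcondr; apply: eq_fsbigl.
by apply/seteqP; split=> g /=; rewrite lg_le.
Qed.

(** * The three sums on the scale x = exp u *)

Context (S : set P) (f : R -> R[i]) (Bf : R).
Hypothesis Bf_ge0 : 0 <= Bf.
Hypothesis f_bounded : forall x, 1 <= x -> cabs (f x) <= Bf.

Definition fS q : R[i] := if q \in S then f (nP q) else 0.

Lemma cabs_fS q : cabs (fS q) <= Bf.
Proof.
rewrite /fS; case: ifP => _; last by rewrite cabs0.
exact/f_bounded/ltW/nP_gt1.
Qed.

Lemma cabs_sum_fS (s : seq P) (x : P -> R) :
  cabs (\sum_(q <- s) fS q * toC (x q)) <= Bf * \sum_(q <- s) `|x q|.
Proof.
apply: (le_trans (cabs_sum _ _ _)); rewrite mulr_sumr; apply: ler_sum => q _.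
by rewrite cabsM cabs_toC ler_wpM2r // cabs_fS.
Qed.

Lemma sum_fS_uniq_min u g : lg g <= u ->
  \sum_(q <- ple u) fS q * (uniq_min q g)%:R =
  if g \in [set g | Dset nP S g /\ g <> Gunit] then f (Nminus nP g) else 0.
Proof.
move=> gu; case: ifPn => [|gD].
  move=> /set_mem /DsetP[q [Sq U]].
  have qu : q \in ple u.
    by rewrite mem_ple (le_trans _ gu) // lg_mem //; case/andP: U.
  rewrite (big_fsetD1 q) //= big_seq big1 ?addr0 => [|p].
    by rewrite U mulr1 /fS mem_set // (uniq_min_Nminus U).
  rewrite !inE => /andP[pq _]; case: (boolP (uniq_min p g)) => [Up|_]; rewrite ?mulr0 //.
  by rewrite (uniq_min_inj Up U) eqxx in pq.
apply: big1 => q _; rewrite /fS; case: ifPn => [|_]; rewrite ?mul0r //.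
move=> /set_mem Sq; case: (boolP (uniq_min q g)) => U; rewrite ?mulr0 //.
by exfalso; move/negP: gD; apply; apply/mem_set/DsetP; exists q.
Qed.

Lemma sum_fS_is_max u g : lg g <= u ->
  \sum_(q <- ple u) fS q * (is_max q g)%:R = (QS nP S g)%:R * f (Nplus nP g).
Proof.
move=> gu; have QE : QS nP S g = (\sum_(q <- ple u) ((q \in S) && is_max q g : nat))%N.
  rewrite /QS (@fsbigE _ _ _ _ _ [seq q <- ple u | (q \in S) && is_max q g]).
  - rewrite big_filter_cond [RHS]big_mkcond /=  [LHS]big_mkcond /=; apply: eq_bigr => q _.
    case: (boolP ((q \in S) && is_max q g)) => //= /andP[qS V]; rewrite ifT //; apply/mem_set.
    move/is_max_Nplus: V => [V1 V2]; split; first exact: set_mem.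
    by split=> //; exact/pdvdGE.
  - by rewrite filter_uniq ?fset_uniq.
  - move=> q /=; rewrite mem_filter => /andP[/andP[qS V] _].
    move/is_max_Nplus: V => [V1 V2]; split; first exact: set_mem.
    by split=> //; exact/pdvdGE.
  move=> q [Sq [/pdvdGE qg qN]] /negP; rewrite mem_filter; case.
  rewrite mem_set //= mem_ple (le_trans (lg_mem qg)) // andbT.
  exact/is_max_Nplus.
rewrite QE natr_sum mulr_suml; apply: eq_bigr => q _; rewrite /fS.
case: (q \in S) => /=; last by rewrite !mul0r.
case: (boolP (is_max q g)) => [/is_max_Nplus[_ <-]|_]; first by rewrite mulr1 mul1r.
by rewrite mulr0 mul0r.
Qed.

Definition X1 u := \sum_(q <- ple u) fS q * toC (xq q u).

Definition Y1 u := \sum_(q <- ple u) fS q * toC (yq q u).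

Lemma X1_to0 : to0 (fun u => cabs (X1 u)).
Proof.
apply: to0_le (to0Z Bf sum_xq_to0) => u; rewrite ger0_norm ?cabs_ge0 //.
exact: cabs_sum_fS.
Qed.

Lemma bsum_fS u (w : P -> G -> R) :
  bsum u (fun g => \sum_(q <- ple u) fS q * toC (w q g)) =
  \sum_(q <- ple u) fS q * toC (bsum u (w q)).
Proof.
rewrite /bsum exchange_big /=; apply: eq_bigr => q _.
by rewrite toC_sum mulr_sumr.
Qed.

Lemma sum_QS u :
  \sum_(g \in [set g | normG nP g <= expR u]) (QS nP S g)%:R * f (Nplus nP g) =
  - toC (expR u) * (X1 u + toC c * Y1 u).
Proof.
have -> : [set g | normG nP g <= expR u] = [set g | lg g <= u].
  by apply/seteqP; split=> g /=; rewrite lg_le.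
rewrite bsum_fin.
transitivity (bsum u (fun g => \sum_(q <- ple u) fS q * toC ((is_max q g)%:R))).
  apply: eq_bsum => g gu; rewrite -(sum_fS_is_max gu); apply: eq_bigr => q _.
  by rewrite toC_nat.
rewrite bsum_fS /X1 /Y1 mulr_sumr -big_split mulr_sumr; apply: eq_bigr => q _ /=.
have -> : bsum u (fun g => (is_max q g)%:R) = - (expR u * (xq q u + c * yq q u)).
  rewrite xq_yq subrK mulrN mulrA -expRD subrr expR0 mul1r opprK; ring.
rewrite toCN toCM toCD toCM; ring.
Qed.

Lemma sum_mobius u :
  \sum_(g \in [set g | normG nP g <= expR u /\ Dset nP S g /\ g <> Gunit])
     mobius g * f (Nminus nP g) / toC (normG nP g) = Y1 u.
Proof.
rewrite (@fsum_le _ u [set g | Dset nP S g /\ g <> Gunit]) /Y1 -bsum_fS.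
apply: eq_bsum => g gu.
transitivity ((toC (mu g) * toC (wt g)) *
   (if g \in [set g | Dset nP S g /\ g <> Gunit] then f (Nminus nP g) else 0)).
  rewrite mu_mobius wtE toCV -/(toC _); case: ifP => _; last by rewrite mulr0.
  by rewrite mulrAC.
rewrite -(sum_fS_uniq_min gu) mulr_sumr; apply: eq_bigr => q _.
rewrite !toCM toC_nat; ring.
Qed.

Context (a : G -> R[i]).
Hypothesis a_supp : forall g, ~ Dset nP S g -> a g = 0.
Hypothesis a_unit : a Gunit = 1.

Lemma mu_convE g : mu_conv a g = \sum_(d <- divs g) toC (mu d) * a (msetB g d).
Proof.
rewrite /mu_conv (@reindex_fsbig _ _ _ _ _ (fun d : G => (d, msetB g d)) [set` divs g]).
  rewrite -fsbig_seq ?fset_uniq //; apply: eq_bigr => d _.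
  by rewrite mu_mobius.
split.
- move=> d /=; rewrite mem_divs => dg.
  by rewrite /Gmul /= msetBDKC.
- by move=> d d' _ _ [].
move=> [h r] /= ->; exists h; last by rewrite /Gmul msetDKB.
by rewrite /= mem_divs -[X in msubset X _]msetD0 msetDS // msub0set.
Qed.

(** Writing g = h r in the expansion of mu * a, the factor a(r)/||r|| comes out and the sum over h
    is I_r, split by q. *)
Lemma sum_mu_conv u :
  \sum_(g \in [set g | normG nP g <= expR u /\ Dset nP S g /\ g <> Gunit])
     mu_conv a g * f (Nminus nP g) / toC (normG nP g) =
  bsum u (fun r => a r * toC (wt r) *
     \sum_(q <- ple u) fS q * toC (iqr q r (u - lg r))).
Proof.
rewrite (@fsum_le _ u [set g | Dset nP S g /\ g <> Gunit]).
pose ph g := \sum_(q <- ple u) fS q * toC ((uniq_min q g)%:R * wt g).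
transitivity (bsum u (fun g => \sum_(d <- divs g) (toC (mu d) * a (msetB g d)) * ph g)).
  apply: eq_bsum => g gu; rewrite -mulr_suml -mu_convE.
  transitivity ((mu_conv a g * toC (wt g)) *
     (if g \in [set g | Dset nP S g /\ g <> Gunit] then f (Nminus nP g) else 0)).
    rewrite wtE toCV; case: ifP => _; last by rewrite mulr0.
    by rewrite mulrAC.
  rewrite -(sum_fS_uniq_min gu) -mulrA; congr (_ * _); rewrite mulr_sumr; apply: eq_bigr => q _.
  rewrite !toCM toC_nat; ring.
rewrite -(bsum_conv u (fun d g => toC (mu d) * a (msetB g d) * ph g)).
under eq_bsum => d _ do under eq_bsum => n _ do rewrite msetDKB.
rewrite bsum_swap; apply: eq_bsum => r _.
transitivity (bsum (u - lg r) (fun h => \sum_(q <- ple u)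
   a r * toC (wt r) * (fS q * toC (mu h * wt h * (uniq_min q (msetD h r))%:R)))).
  apply: eq_bsum => h _; rewrite /ph mulr_sumr; apply: eq_bigr => q _.
  rewrite wtD !toCM; ring.
rewrite /bsum exchange_big mulr_sumr; apply: eq_bigr => q _ /=.
by rewrite /iqr /bsum toC_sum !mulr_sumr.
Qed.

Definition al r := cabs (a r) * wt r.

Lemma al_tail_of_cvg (l : R) :
  (\sum_(g \in [set g | 2 <= normG nP g <= x /\ Dset nP S g])
      cabs (a g) / normG nP g * ln (ln (normG nP g))) @[x --> +oo] --> l ->
  forall e : R, 0 < e -> exists u0 : R, 1 < u0 /\ forall u, u0 <= u ->
    bsum u (fun r => al r * ln (lg r)) - bsum u0 (fun r => al r * ln (lg r)) <= e.
Proof.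
move=> /cvgrPdist_le Hc e e0; have e2 : 0 < e / 2 by rewrite divr_gt0.
have [M [Mr HM]] := Hc _ e2.
pose T g := cabs (a g) / normG nP g * ln (ln (normG nP g)).
pose Q := [set g | 2 <= normG nP g /\ Dset nP S g].
have TE u : \sum_(g \in [set g | 2 <= normG nP g <= expR u /\ Dset nP S g]) T g =
    bsum u (fun g => if g \in Q then T g else 0).
  rewrite -fsum_le; apply: eq_fsbigl; apply/seteqP; split=> g /=.
    by move=> [/andP[h1 h2] h3].
  by move=> [h1 [h2 h3]]; rewrite h1 h2.
have HMu u : M <= u -> `|l - bsum u (fun g => if g \in Q then T g else 0)| <= e / 2.
  move=> Mu; rewrite -TE; apply: HM.
  by apply: lt_le_trans (expR_ge1Dx u); rewrite (le_lt_trans Mu) // ltrDr.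
(* The 2 gives ||g|| >= 2 whenever lg g > u0, so these g occur in the hypothesis on a, and it gives
   1 < u0. *)
pose u0 := Num.max M 2; have [u0M u02] : M <= u0 /\ 2 <= u0.
  by rewrite /u0 !le_max !lexx orbT.
exists u0; split; first by apply: lt_le_trans u02; rewrite ltr1n.
move=> u uu0; have h1 := HMu _ u0M; have h2 := HMu _ (le_trans u0M uu0).
apply: (@le_trans _ _ (bsum u (fun g => if g \in Q then T g else 0) -
                      bsum u0 (fun g => if g \in Q then T g else 0))).
  apply: ler_bsumB => // g gu0 _.
  have g2 : 2 <= normG nP g.
    rewrite -expR_lg (le_trans u02) // (le_trans (ltW gu0)) //.
    by apply: le_trans (expR_ge1Dx _); rewrite lerDr.
  case: (boolP (g \in Q)) => gQ; first by rewrite /al wtE.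
  rewrite /al a_supp ?cabs0 ?mul0r // => gD.
  by move/negP: gQ; apply; apply/mem_set.
move: h1 h2; rewrite !ler_norml => /andP[h1 h2] /andP[h3 h4]; lra.
Qed.

Hypothesis al_tail : forall e : R, 0 < e -> exists u0 : R, 1 < u0 /\ forall u, u0 <= u ->
     bsum u (fun r => al r * ln (lg r)) - bsum u0 (fun r => al r * ln (lg r)) <= e.

Definition Z1 u := bsum u (fun r => a r * toC (wt r) *
     \sum_(q <- ple u) fS q * toC (iqr q r (u - lg r))).

(** The term r = e of [Z1] is [Y1], because a(e) = 1; the others are dominated by Bf times the sums
    in [sum_Jr_to0]. *)
Lemma Z1_Y1_to0 : to0 (fun u => cabs (Z1 u - Y1 u)).
Proof.
have al0 r : 0 <= al r by rewrite mulr_ge0 ?cabs_ge0 ?wt_ge0.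
have := to0Z Bf (sum_Jr_to0 al0 al_tail) => H0.
have {H0} H : to0 (fun u => Bf * `|bsum u (fun r => al r * `|Jr r (u - lg r)|)|).
  apply: to0_ext H0 => u _; congr (_ * _); rewrite ger0_norm //.
  by apply: bsum_ge0 => r _; rewrite mulr_ge0.
(* Values at u < 0 are replaced by 0, since the unit belongs to [gle u] only for u >= 0. *)
apply: to0_ext; last apply: (to0_le (f' := fun u => if 0 <= u then cabs (Z1 u - Y1 u) else 0) _ H).
  by move=> u u0 /=; rewrite u0.
move=> u; case: ifP => u0; last by rewrite normr0 mulr_ge0.
rewrite ger0_norm ?cabs_ge0 // ger0_norm; last first.
  by apply: bsum_ge0 => r _; rewrite mulr_ge0.
rewrite /Z1 /bsum (big_fsetD1 mset0) ?mem_gle ?lg0 //=.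
have -> : a mset0 = 1 by exact: a_unit.
rewrite wt0 mul1r -/(bsum _ _).
have -> : \sum_(q <- ple u) fS q * toC (iqr q mset0 (u - 0)) = Y1 u.
  apply: eq_bigr => q _; congr (_ * toC _); rewrite subr0; apply: eq_bsum => g _.
  by rewrite msetD0 mulrC.
rewrite [toC 1](toC_nat _ 1) mul1r addrAC subrr add0r.
apply: (le_trans (cabs_sum _ _ _)).
rewrite /bsum (big_fsetD1 mset0 (A := gle u)) ?mem_gle ?lg0 //= mulrDr.
apply: ler_wpDl; first by apply: mulr_ge0 => //; apply: mulr_ge0.
rewrite mulr_sumr big_seq [leRHS]big_seq; apply: ler_sum => r.
rewrite !inE mem_gle => /andP[r0 ru].
rewrite !cabsM cabs_toC (ger0_norm (wt_ge0 _)) -/(al r) [leRHS]mulrCA ler_wpM2l //.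
apply: (le_trans (cabs_sum_fS _ _)); rewrite ler_wpM2l // ger0_norm ?sumr_ge0 // /Jr.
rewrite (bigID (fun q => q \in ple (lg r))) /= addrC big1 ?add0r => [|q].
  rewrite -big_filter; apply: ler_sum_sub; rewrite ?filter_uniq ?fset_uniq // => q.
  by rewrite mem_filter => /andP[].
rewrite mem_ple => qr; rewrite /iqr /bsum big1 ?normr0 // => h _.
case: (boolP (uniq_min q _)) => U; rewrite ?mulr0 //; exfalso; move/negP: qr; apply.
apply: uniq_min_lp_le U => //.
by rewrite msetDC -[X in msubset X _]msetD0 msetDS // msub0set.
Qed.

Theorem duality_equiv (delta : R) :
  [<->
   ((\sum_(g \in [set g | normG nP g <= x])
        (QS nP S g)%:R * f (Nplus nP g) - toC (c * delta * x)) / toC x)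
      @[x --> +oo] --> 0;
   (\sum_(g \in [set g | normG nP g <= x /\ Dset nP S g /\ g <> Gunit])
        mobius g * f (Nminus nP g) / toC (normG nP g))
      @[x --> +oo] --> - toC delta;
   (\sum_(g \in [set g | normG nP g <= x /\ Dset nP S g /\ g <> Gunit])
        mu_conv a g * f (Nminus nP g) / toC (normG nP g))
      @[x --> +oo] --> - toC delta].
Proof.
have c0 : toC c != 0 :> R[i].
  by apply/eqP => /(congr1 (@complex.Re R)) /= E; move: c_gt0; rewrite E ltxx.
have X0 := X1_to0; have Z0 := Z1_Y1_to0.
(* As [X1] tends to 0 and c is not 0, this identity makes the quantity in (i) and [Y1] + delta tend
   to 0 together. *)
have E1 : forall u, (\sum_(g \in [set g | normG nP g <= expR u])
        (QS nP S g)%:R * f (Nplus nP g) - toC (c * delta * expR u)) / toC (expR u) - 0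
   = - 1 * X1 u + (- toC c) * (Y1 u + toC delta).
  move=> u; rewrite sum_QS subr0 !toCM.
  have e0 : toC (expR u) != 0 :> R[i].
    by apply/eqP => /(congr1 (@complex.Re R)) /= E; have := expR_gt0 u; rewrite E ltxx.
  by field.
tfae.
- move/cvgC_expR => HF; apply/cvgC_expR.
  apply: (@to0_lin R _ _ _ (- (toC c)^-1) (- (toC c)^-1) _ X0 HF) => u.
  by rewrite sum_mobius E1; field.
- move/cvgC_expR => HF; apply/cvgC_expR.
  apply: (@to0_lin R _ _ _ 1 1 _ Z0 HF) => u.
  by rewrite sum_mobius sum_mu_conv -/(Z1 u); ring.
move/cvgC_expR => HF; apply/cvgC_expR.
(* The way back from (iii) to (i) passes through (ii). *)
have Y0 : to0 (fun u => cabs (Y1 u + toC delta)).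
  apply: (@to0_lin R _ _ _ (- 1) 1 _ Z0 HF) => u.
  by rewrite sum_mu_conv -/(Z1 u); ring.
by apply: (@to0_lin R _ _ _ (- 1) (- toC c) _ X0 Y0) => u; rewrite E1.
Qed.

End Semigroup.

Theorem theorem3p7 (R : realType) (P : countType) (nP : P -> R)
  (c eta : R) (S : set P) (delta : R) (f : R -> R[i]) (a : multiset P -> R[i]) :
  (* arithmetical semigroup: ||p|| > 1 for primes, N(x) finite *)
  (forall p, 1 < nP p) ->
  (forall x : R, finite_set [set g | normG nP g <= x]) ->
  (* Axiom A *)
  0 < c -> 0 < eta < 1 ->
  (exists C M : R, forall x : R, M <= x ->
      `|countG nP x - c * x| <= C * x `^ eta) ->
  (* S has natural density delta *)
  (countP nP S x / countP nP setT x) @[x --> +oo] --> delta ->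
  (* f bounded on [1, oo), f(1) = 0 *)
  (exists B : R, forall x : R, 1 <= x -> cabs (f x) <= B) ->
  f 1 = 0 ->
  (* a supported on D(G,S), a(e) = 1, summability condition *)
  (forall g, ~ Dset nP S g -> a g = 0) ->
  a (Gunit) = 1 ->
  (exists l : R,
     (\sum_(g \in [set g | 2 <= normG nP g <= x /\ Dset nP S g])
         cabs (a g) / normG nP g * ln (ln (normG nP g))) @[x --> +oo] --> l) ->
  [<->
   (* (i) *)
   ((\sum_(g \in [set g | normG nP g <= x])
        (QS nP S g)%:R * f (Nplus nP g) - toC (c * delta * x)) / toC x)
      @[x --> +oo] --> 0;
   (* (ii) *)
   (\sum_(g \in [set g | normG nP g <= x /\ Dset nP S g /\ g <> Gunit])
        mobius g * f (Nminus nP g) / toC (normG nP g))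
      @[x --> +oo] --> - toC delta;
   (* (iii) *)
   (\sum_(g \in [set g | normG nP g <= x /\ Dset nP S g /\ g <> Gunit])
        mu_conv a g * f (Nminus nP g) / toC (normG nP g))
      @[x --> +oo] --> - toC delta].
Proof.
move=> nP_gt1 finN c0 /andP[eta0 eta1] [C [M HC]] _ [B HB] _ a_supp a_unit [l Hl].
have [C' [C'0 axA]] := log_axiomA nP_gt1 finN (ltW c0) (ltW eta0) HC.
have B0 : 0 <= B by apply: le_trans (HB 1 (lexx _)); exact: cabs_ge0.
exact: (duality_equiv nP_gt1 finN c0 C'0 eta1 axA S B0 HB a_unit
  (al_tail_of_cvg nP_gt1 finN a_supp Hl)).
Qed.
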